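(* Let $\mathcal M=(M,<,+,0,\ldots)$ be a definably complete locally o-minimal expansion of an ordered abelian group. Let $C\subseteq M^m$ be a definable closed set and $P\subseteq M^n$ a nonempty definable set, and let $\pi:C\times P\to P$ be the projection. Let $f:C\times P\to M$ be a definable function which is equi-continuous with respect to $P$, and let $D=\{(x,q)\in C\times P : f \text{ is discontinuous at } (x,q)\}$. Then $\dim \pi(D)<\dim P$.
   Context: ''Definable'' means definable with parameters. Definably complete: every definable subset of $M$ has a supremum and infimum in $M\cup\{\pm\infty\}$. Locally o-minimal: for every definable $X\subseteq M$ and $a\in M$ there is an open interval $I\ni a$ with $X\cap I$ a finite union of points and open intervals. $|x|=\max_i|x_i|$ on $M^k$; $C\times P$ has the subspace topology of the product order topology. $f$ is equi-continuous with respect to $P$ if for all $\varepsilon>0$ and $x\in C$ there is $\delta>0$ such that for all $p\in P$ and $x'\in C$ with $|x-x'|<\delta$, $|f(x,p)-f(x',p)|<\varepsilon$. The dimension of a nonempty definable $X\subseteq M^n$ is the maximal $d$ such that $\rho(X)$ has nonempty interior for some coordinate projection $\rho:M^n\to M^d$ ($M^0$ a point); $\dim\emptyset=-\infty$. *)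

(* Defs.v *)
From HB Require Import structures.
From mathcomp Require Import all_boot all_algebra.
From mathcomp Require Import boolp classical_sets.
From Stdlib Require List.

Set Implicit Arguments.
Unset Strict Implicit.
Unset Printing Implicit Defensive.

Import GRing.Theory.
Local Open Scope ring_scope.
Local Open Scope classical_set_scope.

Definition pt (M : Type) (k : nat) := 'I_k -> M.

Section Setting.
Variables (M : zmodType) (lt : rel M).

Definition ordered_abelian_group : Prop :=
  [/\ irreflexive lt, transitive lt,
      (forall x y, [\/ lt x y, x = y | lt y x])
    & (forall x y z, lt x y -> lt (x + z) (y + z))].

Definition le (x y : M) : bool := lt x y || (x == y).

Definition snoc k (x : pt M k) (y : M) : pt M k.+1 :=
  fun i => if unlift ord_max i is Some j then x j else y.
Definition init k (z : pt M k.+1) : pt M k :=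
  fun i => z (widen_ord (leqnSn k) i).
Definition lft m n (z : pt M (m + n)) : pt M m := fun j => z (lshift n j).
Definition rgt m n (z : pt M (m + n)) : pt M n := fun j => z (rshift m j).
Definition catp m n (x : pt M m) (p : pt M n) : pt M (m + n) :=
  fun i => match split i with inl j => x j | inr j => p j end.

(* Def k A  means: A (a subset of M^k) is definable (with parameters).
   The axioms below say that Def is the collection of definable sets of a
   first-order expansion of (M,<,+,0) (with parameters): boolean algebras,
   closure under substitution of variables (coordinate maps: products with M,
   permutations, diagonals), projections, and containing <, the graph of +,
   and all singletons. *)
Record structure_on (Def : forall k, set (pt M k) -> Prop) : Prop := {
  def_empty : forall k, @Def k set0;
  def_compl : forall k (A : set (pt M k)), @Def k A -> @Def k (~` A);
  def_union : forall k (A B : set (pt M k)), @Def k A -> @Def k B -> @Def k (A `|` B);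
  def_comap : forall k l (s : 'I_k -> 'I_l) (A : set (pt M k)),
      @Def k A -> @Def l [set x | A (fun i => x (s i))];
  def_proj : forall k (A : set (pt M k.+1)),
      @Def k.+1 A -> @Def k [set x | exists y, A (snoc x y)];
  def_eq : @Def 2%N [set x | x ord0 = x ord_max];
  def_lt : @Def 2%N [set x | lt (x ord0) (x ord_max)];
  def_add : @Def 3%N [set x | x ord_max = x ord0 + x (inord 1%N)];
  def_const : forall a : M, @Def 1%N [set x | x ord0 = a]
}.

Variable Def : forall k, set (pt M k) -> Prop.

Definition definable1 (X : set M) : Prop := @Def 1%N [set x | X (x ord0)].

(* Definable completeness: every definable subset of M has a supremum and an
   infimum in M u {-oo,+oo}.  (Sup = -oo iff empty, +oo iff unbounded above;
   so the content is: nonempty bounded-above definable sets have a least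
   upper bound in M, dually for infima.) *)
Definition def_complete : Prop :=
  forall X : set M, definable1 X -> (exists x, X x) ->
    ((exists b, forall x, X x -> le x b) ->
       exists s, (forall x, X x -> le x s) /\
                 (forall b, (forall x, X x -> le x b) -> le s b)) /\
    ((exists b, forall x, X x -> le b x) ->
       exists s, (forall x, X x -> le s x) /\
                 (forall b, (forall x, X x -> le b x) -> le b s)).

(* open intervals with endpoints in M u {-oo,+oo}: None = -oo (lower), +oo (upper) *)
Definition itv (a b : option M) (y : M) : Prop :=
  (if a is Some a' then lt a' y else True) /\ (if b is Some b' then lt y b' else True).

Definition loc_omin : Prop :=
  forall X : set M, definable1 X -> forall a : M,
    exists (b c : option M), itv b c a /\
      exists (pts : seq M) (ivs : seq (option M * option M)),
        forall y, (X y /\ itv b c y) <->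
          (List.In y pts \/ exists iv, List.In iv ivs /\ itv iv.1 iv.2 y).

Definition box k (a b : 'I_k -> option M) : set (pt M k) :=
  [set x | forall i, itv (a i) (b i) (x i)].
Definition nbhd k (z : pt M k) (U : set (pt M k)) : Prop :=
  exists a b, box a b z /\ box a b `<=` U.
Definition open_set k (U : set (pt M k)) : Prop := forall z, U z -> nbhd z U.
Definition closed_set k (C : set (pt M k)) : Prop := open_set (~` C).
Definition has_interior k (U : set (pt M k)) : Prop := exists z, nbhd z U.

Definition cont_at k (S : set (pt M k)) (g : pt M k -> M) (z : pt M k) : Prop :=
  forall a b, itv a b (g z) ->
    exists a' b', box a' b' z /\ forall w, S w -> box a' b' w -> itv a b (g w).

Definition absM (x : M) : M := if lt x 0 then - x else x.
Definition maxM (x y : M) : M := if lt x y then y else x.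
Definition nrm k (x : pt M k) : M := \big[maxM/0]_(i < k) absM (x i).

Section Fun.
Variables (m n : nat) (C : set (pt M m)) (P : set (pt M n)) (f : pt M m -> pt M n -> M).

Definition CxP : set (pt M (m + n)) := [set z | C (lft z) /\ P (rgt z)].
Definition fj (z : pt M (m + n)) : M := f (lft z) (rgt z).

Definition definable_fun : Prop :=
  @Def (m + n).+1 [set z | CxP (init z) /\ z ord_max = fj (init z)].

Definition equicont : Prop :=
  forall eps, lt 0 eps -> forall x, C x ->
    exists delta, lt 0 delta /\
      forall p x', P p -> C x' ->
        lt (nrm (fun i => x i - x' i)) delta -> lt (absM (f x p - f x' p)) eps.

Definition proj_disc : set (pt M n) :=
  [set q | exists x, C x /\ P q /\ ~ cont_at CxP fj (catp x q)].
End Fun.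

(* Dimension: None = -oo. *)
Definition coord_proj k d (s : 'I_d -> 'I_k) (X : set (pt M k)) : set (pt M d) :=
  [set y | exists x, X x /\ forall i, y i = x (s i)].
Definition proj_int k (X : set (pt M k)) (d : nat) : Prop :=
  exists s : 'I_d -> 'I_k, (forall i j : 'I_d, (i < j)%N -> (s i < s j)%N) /\
    has_interior (coord_proj s X).
Definition dimension k (X : set (pt M k)) : option nat :=
  if `[< exists x, X x >] then Some (\max_(d < k.+1 | `[< proj_int X d >]) (d : nat))
  else None.
End Setting.

Definition dim_lt (a b : option nat) : Prop :=
  match a, b with
  | None, Some _ => True
  | Some x, Some y => (x < y)%N
  | _, None => False
  end.

(* Main.v *)
(* Write [pi] for the projection [C * P -> P]. By equicontinuity, [f] is discontinuous at [(x, q)]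
   iff [f x] is discontinuous at [q]. In the dense case (otherwise every point of [M] is isolated)
   one shows, by induction on the dimension, that every open ball contains a smaller ball on which
   a given definable set is full or empty, a given positive definable function is bounded away
   from 0, and a given definable function oscillates little; on the line this follows from local
   o-minimality at a single endpoint. If [dim pi(D) = dim P = d], definable choice over a ball of
   [M^d] gives a section [q] of [P], points [x y] of [C], a lower bound of the oscillation of
   [f (x y)] at [q y] and a modulus of equicontinuity at [x y]. On a smaller ball all of these are
   almost constant, so a single [f x0] oscillates at every [q y], and every [q y] is a limit of
   points of [P] off the section. Then the fibers of [P] over [M^d] are not discrete, some
   coordinate of theirs covers an interval, uniformly on a ball, and [dim P > d]. *)
Require Import Defs.
From HB Require Import structures.
From mathcomp Require Import all_boot all_algebra.
From mathcomp Require Import boolp classical_sets.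

Set Implicit Arguments.
Unset Strict Implicit.
Unset Printing Implicit Defensive.

Import GRing.Theory.
Local Open Scope ring_scope.

(** * Identities in abelian groups *)

Inductive zexpr := ZVar of nat | ZZero | ZAdd of zexpr & zexpr | ZOpp of zexpr.

Fixpoint zeval (M : zmodType) (env : seq M) (e : zexpr) : M :=
  match e with
  | ZVar i => env`_i
  | ZZero => 0
  | ZAdd a b => zeval env a + zeval env b
  | ZOpp a => - zeval env a
  end.

(* Number of occurrences of variable [i] with positive ([s = true]) or negative sign. *)
Fixpoint zcount (s : bool) (e : zexpr) (i : nat) : nat :=
  match e with
  | ZVar j => if s then (i == j : nat) else 0%N
  | ZZero => 0%N
  | ZAdd a b => (zcount s a i + zcount s b i)%N
  | ZOpp a => zcount (~~ s) a i
  end.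

Lemma zevalE (M : zmodType) (env : seq M) (e : zexpr) :
  zeval env e =
  \sum_(i < size env) (env`_i *+ zcount true e i - env`_i *+ zcount false e i).
Proof.
elim: e => [j||a IHa b IHb|a IHa] /=.
- have [jlt|jge] := ltnP j (size env).
    rewrite (bigD1 (Ordinal jlt)) //= eqxx mulr1n mulr0n subr0 big1 ?addr0 // => i.
    by rewrite -val_eqE /= => /negPf ->; rewrite mulr0n subr0.
  rewrite nth_default // big1 // => i _.
  by rewrite (ltn_eqF (leq_trans (ltn_ord i) jge)) mulr0n subr0.
- by rewrite big1 // => i _; rewrite subr0.
- rewrite IHa IHb -big_split; apply: eq_bigr => i _ /=.
  by rewrite !mulrnDr opprD addrACA.
- by rewrite IHa -sumrN; apply: eq_bigr => i _ /=; rewrite opprB.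
Qed.

(** Both sides expand over the variables of [env]. Moving negative occurrences to the other side
    keeps the comparison in natural numbers, so the hypothesis is checked by computation. *)
Lemma zeval_eq (M : zmodType) (env : seq M) (a b : zexpr) :
  all (fun i => zcount true a i + zcount false b i ==
                zcount true b i + zcount false a i)%N (iota 0 (size env)) ->
  zeval env a = zeval env b.
Proof.
move=> /allP h; rewrite !zevalE; apply: eq_bigr => i _.
have /h/eqP E : nat_of_ord i \in iota 0 (size env) by rewrite mem_iota /= add0n.
by apply/eqP; rewrite subr_eq addrAC eq_sym subr_eq -!mulrnDr E.
Qed.

Ltac zindex x l :=
  match l with
  | x :: _ => constr:(0%N)
  | _ :: ?l' => let n := zindex x l' in constr:(n.+1)
  end.

Ltac zinsert x l :=
  match l with
  | _ => let n := zindex x l in l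
  | _ => constr:(x :: l)
  end.

Ltac zvars e l :=
  lazymatch e with
  | (?a + ?b)%R => let l' := zvars a l in zvars b l'
  | (- ?a)%R => zvars a l
  | 0%R => l
  | _ => zinsert e l
  end.

Ltac zreify e l :=
  lazymatch e with
  | (?a + ?b)%R => let x := zreify a l in let y := zreify b l in constr:(ZAdd x y)
  | (- ?a)%R => let x := zreify a l in constr:(ZOpp x)
  | 0%R => constr:(ZZero)
  | _ => let n := zindex e l in constr:(ZVar n)
  end.

Ltac zmod :=
  lazymatch goal with
  | |- @eq ?T ?a ?b =>
    let l := zvars a (@nil T) in
    let l := zvars b l in
    let x := zreify a l in
    let y := zreify b l in
    exact: (@zeval_eq _ l x y isT)
  end.

(** * Order and linear inequalities in ordered abelian groups *)

Section OrderedGroup.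
Variables (M : zmodType) (lt : rel M).
Hypothesis hG : ordered_abelian_group lt.
Local Notation le := (le lt).

Lemma ltxx x : lt x x = false. Proof. by case: hG. Qed.
Lemma lt_tr y x z : lt x y -> lt y z -> lt x z.
Proof. by case: hG => _ tr _ _; apply: tr. Qed.
Lemma ltP x y : [\/ lt x y, x = y | lt y x]. Proof. by case: hG. Qed.
Lemma leW x y : lt x y -> le x y. Proof. by rewrite /Defs.le => ->. Qed.
Lemma lexx x : le x x. Proof. by rewrite /Defs.le eqxx orbT. Qed.
Lemma le_or_lt x y : le x y \/ lt y x.
Proof.
by rewrite /Defs.le; case: (ltP x y) => [->|->|]; rewrite ?eqxx ?orbT; [left|left|right].
Qed.
Lemma lt_le_false x y : lt x y -> le y x -> False.
Proof.
move=> xy /orP[yx|/eqP E]; first by have := lt_tr xy yx; rewrite ltxx.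
by rewrite E ltxx in xy.
Qed.
Lemma nltE x y : ~ lt x y <-> le y x.
Proof.
split=> [n|yx xy]; last exact: lt_le_false xy yx.
by case: (le_or_lt y x) => // /n.
Qed.
Lemma nleE x y : ~ le x y <-> lt y x.
Proof.
split=> [n|yx xy]; last exact: lt_le_false yx xy.
by case: (le_or_lt x y) => // /n.
Qed.
Lemma le_lt_tr y x z : le x y -> lt y z -> lt x z.
Proof. by move=> /orP[xy|/eqP ->] //; apply: lt_tr. Qed.
Lemma lt_le_tr y x z : lt x y -> le y z -> lt x z.
Proof. by move=> xy /orP[yz|/eqP <-] //; apply: lt_tr yz. Qed.
Lemma le_tr y x z : le x y -> le y z -> le x z.
Proof. by move=> /orP[xy|/eqP ->] // yz; apply: leW; apply: lt_le_tr yz. Qed.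

Lemma ltD a b c d : lt a b -> lt c d -> lt (a + c) (b + d).
Proof.
case: hG => _ tr _ ad ab cd; apply: (tr (b + c)); first exact: ad.
by rewrite ![b + _]addrC; apply: ad.
Qed.
Lemma ltD_le a b c d : lt a b -> le c d -> lt (a + c) (b + d).
Proof.
by move=> ab /orP[|/eqP ->]; [apply: ltD | case: hG => _ _ _; apply].
Qed.
Lemma leD_lt a b c d : le a b -> lt c d -> lt (a + c) (b + d).
Proof. by move=> ab cd; rewrite addrC [b + d]addrC; apply: ltD_le. Qed.
Lemma leD a b c d : le a b -> le c d -> le (a + c) (b + d).
Proof.
move=> ab /orP[cd|/eqP ->]; first exact: leW (leD_lt ab cd).
by move: ab => /orP[ab|/eqP ->]; [apply: leW; apply: ltD_le (lexx _) | apply: lexx].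
Qed.

(** Equal differences transfer an inequality, so a linear goal reduces to a group identity that
    [zmod] can check. *)
Lemma lt_conv a b c d : lt a b -> d - c = b - a -> lt c d.
Proof.
case: hG => _ _ _ ad /(ad _ _ (c - a)) h E.
have -> : c = a + (c - a) by zmod.
by have -> : d = b + (c - a) by rewrite -[LHS](subrK c) E; zmod.
Qed.
Lemma le_conv a b c d : le a b -> d - c = b - a -> le c d.
Proof.
move=> /orP[ab E|/eqP ->]; first exact: leW (lt_conv ab E).
by rewrite subrr => /eqP; rewrite subr_eq0 => /eqP ->; apply: lexx.
Qed.
End OrderedGroup.

(** The arguments of [lin] are a certificate: their sum has the same difference as the goal.
    Repeating an argument gives it a coefficient, and the sum is strict as soon as one summand
    is. *)
Ltac lsum hG h1 h2 :=
  match goal with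
  | _ => constr:(ltD hG h1 h2)
  | _ => constr:(ltD_le hG h1 h2)
  | _ => constr:(leD_lt hG h1 h2)
  | _ => constr:(leD hG h1 h2)
  end.

Ltac lfin hG h :=
  first [ apply: (lt_conv hG h) | apply: (le_conv hG h) | apply: (le_conv hG (leW h)) ]; zmod.

Tactic Notation "lin" constr(hG) constr(h1) := lfin hG h1.
Tactic Notation "lin" constr(hG) constr(h1) constr(h2) :=
  let h := lsum hG h1 h2 in lfin hG h.
Tactic Notation "lin" constr(hG) constr(h1) constr(h2) constr(h3) :=
  let h := lsum hG h1 h2 in let h := lsum hG h h3 in lfin hG h.
Tactic Notation "lin" constr(hG) constr(h1) constr(h2) constr(h3) constr(h4) :=
  let h := lsum hG h1 h2 in let h := lsum hG h h3 in let h := lsum hG h h4 in lfin hG h.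

(** * Closeness of elements and the maximum norm *)

Section Near.
Variables (M : zmodType) (lt : rel M).
Hypothesis hG : ordered_abelian_group lt.
Local Notation le := (le lt).

(** Stated as two inequalities instead of an absolute value, so that each half can be fed directly
    to [lin]. *)
Definition near (r x y : M) : Prop := lt x (y + r) /\ lt y (x + r).

Lemma near_refl r x : lt 0 r -> near r x x.
Proof. by move=> r0; split; lin hG r0. Qed.
Lemma near_sym r x y : near r x y -> near r y x.
Proof. by case. Qed.
Lemma near_tr y r s x z : near r x y -> near s y z -> near (r + s) x z.
Proof. by move=> [a b] [c d]; split; [lin hG a c|lin hG b d]. Qed.
Lemma near_le r s x y : le r s -> near r x y -> near s x y.
Proof. by move=> rs [a b]; split; [lin hG a rs|lin hG b rs]. Qed.
Lemma nearP r x y : lt (absM lt (x - y)) r <-> near r x y.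
Proof.
rewrite /absM /near; case: ifP => [l|/negP/(nltE hG) l]; split=> [h|[h1 h2]].
- by split; [lin hG h l l|lin hG h].
- by lin hG h2.
- by split; [lin hG h|lin hG h l l].
- by lin hG h1.
Qed.

Lemma exists_min (a b : M) : exists c, [/\ le c a, le c b & c = a \/ c = b].
Proof.
case: (le_or_lt hG a b) => h; first by exists a; split => //; [apply: lexx|left].
by exists b; split; [apply: leW|apply: lexx|right].
Qed.
Lemma exists_min_pos (a b : M) : lt 0 a -> lt 0 b -> exists c, [/\ lt 0 c, le c a & le c b].
Proof.
by move=> a0 b0; have [c [ca cb [E|E]]] := exists_min a b; exists c; split => //; rewrite E.
Qed.

Lemma maxM_lt x y r : lt (maxM lt x y) r <-> lt x r /\ lt y r.
Proof.
rewrite /maxM; case: ifP => [l|/negP/(nltE hG) l]; split=> [h|[]//].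
- by split => //; apply: lt_tr h.
- by split => //; apply: le_lt_tr h.
Qed.
(** The maximum starts from 0, hence the positive bound: it covers the empty tuple. *)
Lemma nrmP k (x y : pt M k) r : lt 0 r ->
  lt (nrm lt (fun i => x i - y i)) r <-> forall i, near r (x i) (y i).
Proof.
move=> r0; rewrite /nrm.
have -> : (forall i, near r (x i) (y i)) <->
          (forall i, i \in index_enum 'I_k -> near r (x i) (y i)).
  by split=> h i // ; apply: h; rewrite mem_index_enum.
elim: (index_enum _) => [|j s IH]; first by rewrite big_nil; split.
rewrite big_cons maxM_lt nearP IH; split=> [[hj h] i|h].
  by rewrite in_cons => /orP[/eqP ->|/h].
by split=> [|i i_s]; apply: h; rewrite in_cons ?eqxx ?i_s ?orbT.
Qed.
End Near.

(** * Definable predicates and terms *)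

Section Tuples.
Variable M : zmodType.

Lemma snoc_max k (x : pt M k) y : snoc x y ord_max = y.
Proof. by rewrite /snoc unlift_none. Qed.
Lemma snoc_widen k (x : pt M k) y i : snoc x y (widen_ord (leqnSn k) i) = x i.
Proof.
rewrite /snoc; case: unliftP => [j|] /(congr1 val) /=.
  by rewrite /bump leqNgt ltn_ord /= => /val_inj ->.
by move=> E; have := ltn_ord i; rewrite E ltnn.
Qed.
Lemma init_snoc k (x : pt M k) y : init (snoc x y) = x.
Proof. by apply: funext => i; apply: snoc_widen. Qed.
Lemma ord_maxVwiden k (i : 'I_k.+1) : i = ord_max \/ exists j, i = widen_ord (leqnSn k) j.
Proof.
case: (unliftP ord_max i) => [j ->|]; [right; exists j|by left].
by apply: val_inj; rewrite /= /bump leqNgt ltn_ord.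
Qed.
Lemma snoc_init k (z : pt M k.+1) : snoc (init z) (z ord_max) = z.
Proof.
apply: funext => i.
by case: (ord_maxVwiden i) => [->|[j ->]]; rewrite ?snoc_max ?snoc_widen.
Qed.
Lemma lft_catp m n (x : pt M m) (p : pt M n) : lft (catp x p) = x.
Proof. by apply: funext => i; rewrite /lft /catp (unsplitK (inl i)). Qed.
Lemma rgt_catp m n (x : pt M m) (p : pt M n) : rgt (catp x p) = p.
Proof. by apply: funext => i; rewrite /rgt /catp (unsplitK (inr i)). Qed.
Lemma pt0_eq (x y : pt M 0) : x = y.
Proof. by apply: funext => -[]. Qed.
End Tuples.

Section Definability.
Variables (M : zmodType) (lt : rel M) (Def : forall k, set (pt M k) -> Prop).
Hypothesis hG : ordered_abelian_group lt.
Hypothesis hS : structure_on lt Def.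
Local Notation le := (le lt).

Definition dterm k (t : pt M k -> M) : Prop :=
  Def (fun z : pt M k.+1 => z ord_max = t (init z)).
Definition dmap k l (t : pt M k -> pt M l) : Prop := forall i, dterm (fun x => t x i).

Lemma def_ext k (A B : pt M k -> Prop) : (forall x, A x <-> B x) -> Def A -> Def B.
Proof. by move=> h; have -> : A = B by apply: funext => x; apply: propext. Qed.

Lemma def_not k (A : pt M k -> Prop) : Def A -> Def (fun x => ~ A x).
Proof. exact: (def_compl hS). Qed.
Lemma def_or k (A B : pt M k -> Prop) : Def A -> Def B -> Def (fun x => A x \/ B x).
Proof. exact: (def_union hS). Qed.
Lemma def_and k (A B : pt M k -> Prop) : Def A -> Def B -> Def (fun x => A x /\ B x).
Proof.
move=> dA dB; apply: def_ext (def_not (def_or (def_not dA) (def_not dB))) => x.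
by split=> [/not_orP[/contrapT ? /contrapT]|[a b] []].
Qed.
Lemma def_imp k (A B : pt M k -> Prop) : Def A -> Def B -> Def (fun x => A x -> B x).
Proof.
move=> dA dB; apply: def_ext (def_or (def_not dA) dB) => x.
split=> [[]//|h]; have [/h|] := pselect (A x); [by right|by left].
Qed.
Lemma def_cst k (A : Prop) : Def (fun _ : pt M k => A).
Proof.
have [a|na] := pselect A.
  by apply: def_ext (def_not (def_empty hS k)) => x; split=> // _ [].
by apply: def_ext (def_empty hS k) => x; split=> // -[].
Qed.
Lemma def_ex k (A : pt M k -> M -> Prop) :
  Def (fun z : pt M k.+1 => A (init z) (z ord_max)) -> Def (fun x => exists y, A x y).
Proof.
move=> dA; apply: def_ext (def_proj hS dA) => x /=.
by split=> -[y h]; exists y; move: h; rewrite init_snoc snoc_max.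
Qed.
Lemma def_all k (A : pt M k -> M -> Prop) :
  Def (fun z : pt M k.+1 => A (init z) (z ord_max)) -> Def (fun x => forall y, A x y).
Proof.
move=> dA; apply: def_ext (def_not (def_ex (A := fun x y => ~ A x y) (def_not dA))) => x.
by split=> [/forallNP h y|h [y]]; [apply: contrapT; apply: h|apply; apply: h].
Qed.
(** The tuple is projected away one coordinate at a time; the cast along [addnS] turns its last
    coordinate into the last one overall. *)
Lemma def_exv k l (A : pt M k -> pt M l -> Prop) :
  Def (fun z : pt M (k + l) => A (lft z) (rgt z)) -> Def (fun x => exists y, A x y).
Proof.
elim: l A => [|l IH] A dA.
  have := def_comap hS (cast_ord (addn0 k)) dA; apply: def_ext => x /=.
  have -> : lft (fun i => x (cast_ord (addn0 k) i)) = x.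
    by apply: funext => i; rewrite /lft; congr x; apply: val_inj.
  by split=> [h|[y]]; [eexists; exact: h|rewrite [y](pt0_eq _ (rgt (fun i => x (cast_ord (addn0 k) i))))].
have : Def (fun x => exists y, exists u, A x (snoc y u)).
  apply: IH; apply: (@def_ex _ (fun z u => A (lft z) (snoc (rgt z) u))).
  have := def_comap hS (cast_ord (addnS k l)) dA; apply: def_ext => w /=.
  suff -> : lft (fun i => w (cast_ord (addnS k l) i)) = lft (init w).
    suff -> : rgt (fun i => w (cast_ord (addnS k l) i)) = snoc (rgt (init w)) (w ord_max) by [].
    apply: funext => i; rewrite /rgt /init.
    case: (ord_maxVwiden i) => [->|[j ->]]; rewrite ?snoc_max ?snoc_widen; congr w; exact: val_inj.
  by apply: funext => i; rewrite /lft /init; congr w; apply: val_inj.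
apply: def_ext => x; split=> [[y [u h]]|[y h]]; first by exists (snoc y u).
by exists (init y), (y ord_max); rewrite snoc_init.
Qed.
Lemma def_allv k l (A : pt M k -> pt M l -> Prop) :
  Def (fun z : pt M (k + l) => A (lft z) (rgt z)) -> Def (fun x => forall y, A x y).
Proof.
move=> dA; apply: def_ext (def_not (def_exv (A := fun x y => ~ A x y) (def_not dA))) => x.
by split=> [/forallNP h y|h [y]]; [apply: contrapT; apply: h|apply; apply: h].
Qed.
Lemma def_alli k l (A : pt M k -> 'I_l -> Prop) :
  (forall i, Def (fun x => A x i)) -> Def (fun x => forall i, A x i).
Proof.
move=> dA.
have : Def (fun x => forall i, i \in enum 'I_l -> A x i).
  elim: (enum _) => [|j s IH]; first by apply: def_ext (def_cst k True).
  apply: def_ext (def_and (dA j) IH) => x; split=> [[h1 h2] i|h].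
    by rewrite in_cons => /orP[/eqP ->|/h2].
  by split=> [|i i_s]; apply: h; rewrite in_cons ?eqxx ?i_s ?orbT.
by apply: def_ext => x; split=> h i; [apply: h; rewrite mem_enum|move=> _; apply: h].
Qed.

Lemma dterm_var k (i : 'I_k) : dterm (fun x => x i).
Proof.
have := def_comap hS (fun j : 'I_2 => if j == ord0 then ord_max else widen_ord (leqnSn k) i)
  (def_eq hS).
by apply: def_ext.
Qed.

(** [A (t x)] is rewritten as the existence of some [y] equal to [t x] coordinatewise with [A y],
    which uses only the graphs of the coordinates of [t]. *)
Lemma def_comp k l (t : pt M k -> pt M l) (A : pt M l -> Prop) :
  Def A -> dmap t -> Def (fun x => A (t x)).
Proof.
move=> dA dt.
have : Def (fun x => exists y, (forall i, y i = t x i) /\ A y).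
  apply: def_exv; apply: def_and; last exact: (def_comap hS (@rshift k l) dA).
  apply: def_alli => i.
  have := def_comap hS (fun j : 'I_k.+1 => if unlift ord_max j is Some j' then lshift l j'
                                else rshift k i) (dt i).
  apply: def_ext => z /=; rewrite unlift_none /rgt.
  set u := init _; suff -> : u = lft z by [].
  apply: funext => j; rewrite /u /init /lft.
  by have -> : widen_ord (leqnSn k) j = lift ord_max j; [apply: val_inj; rewrite /= /bump leqNgt ltn_ord | rewrite liftK].
apply: def_ext => x; split=> [[y [h]]|h]; last by exists (t x).
by have -> : y = t x by apply: funext.
Qed.

Lemma dmap_snoc k l (t : pt M k -> pt M l) u :
  dmap t -> dterm u -> dmap (fun x => snoc (t x) (u x)).
Proof.
move=> dt du i; case: (ord_maxVwiden i) => [->|[j ->]].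
  by have -> : (fun x => snoc (t x) (u x) ord_max) = u by apply: funext => x; rewrite snoc_max.
by have -> : (fun x => snoc (t x) (u x) (widen_ord (leqnSn l) j)) = (fun x => t x j);
  [apply: funext => x; rewrite snoc_widen|].
Qed.

Lemma dmap_catp k l m (t : pt M k -> pt M l) (u : pt M k -> pt M m) :
  dmap t -> dmap u -> dmap (fun x => catp (t x) (u x)).
Proof. by move=> dt du i; rewrite /catp; case: (split i) => j. Qed.

Lemma dterm_comap k l (s : 'I_k -> 'I_l) (t : pt M k -> M) :
  dterm t -> dterm (fun x => t (fun i => x (s i))).
Proof.
move=> dt.
have dm : dmap (fun z : pt M l.+1 => snoc (fun i => init z (s i)) (z ord_max)).
  by apply: dmap_snoc => [i|]; apply: dterm_var.
have := def_comp dt dm; apply: def_ext => z /=.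
by rewrite snoc_max init_snoc.
Qed.

Lemma dterm_comp k l (t : pt M k -> pt M l) (u : pt M l -> M) :
  dterm u -> dmap t -> dterm (fun x => u (t x)).
Proof.
move=> du dt.
have dm : dmap (fun z : pt M k.+1 => snoc (t (init z)) (z ord_max)).
  by apply: dmap_snoc => [i|]; [apply: (dterm_comap _ (dt i))|apply: dterm_var].
have := def_comp du dm; apply: def_ext => z.
by rewrite snoc_max init_snoc.
Qed.
Lemma dmap_nil k : dmap (fun (_ : pt M k) (i : 'I_0) => 0).
Proof. by case. Qed.

Lemma def_rel1 (A : M -> Prop) k (t : pt M k -> M) :
  Def (fun z : pt M 1 => A (z ord0)) -> dterm t -> Def (fun x => A (t x)).
Proof.
move=> dA dt; apply: (def_comp (t := fun x _ => t x) dA).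
by move=> i; apply: dt.
Qed.
Lemma def_rel2 (A : M -> M -> Prop) k (t u : pt M k -> M) :
  Def (fun z : pt M 2 => A (z ord0) (z ord_max)) -> dterm t -> dterm u ->
  Def (fun x => A (t x) (u x)).
Proof.
move=> dA dt du; apply: def_ext (def_comp dA (dmap_snoc (dmap_snoc (@dmap_nil k) dt) du)) => x.
rewrite snoc_max.
by have -> : ord0 = widen_ord (leqnSn 1) ord_max; [apply: val_inj|rewrite snoc_widen snoc_max].
Qed.
Lemma def_lt2 k (t u : pt M k -> M) : dterm t -> dterm u -> Def (fun x => lt (t x) (u x)).
Proof. exact: (def_rel2 (A := fun a b => lt a b) (def_lt hS)). Qed.
Lemma def_eq2 k (t u : pt M k -> M) : dterm t -> dterm u -> Def (fun x => t x = u x).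
Proof. exact: (def_rel2 (A := fun a b => a = b) (def_eq hS)). Qed.
Lemma def_le2 k (t u : pt M k -> M) : dterm t -> dterm u -> Def (fun x => le (t x) (u x)).
Proof.
move=> dt du; apply: def_ext (def_not (def_lt2 du dt)) => x; exact: nltE.
Qed.

Lemma dterm_cst k a : dterm (fun _ : pt M k => a).
Proof. exact: (def_rel1 (A := fun x => x = a) (def_const hS a) (dterm_var ord_max)). Qed.
Lemma dterm_weaken k (t : pt M k -> M) : dterm t -> dterm (fun z => t (init z)).
Proof. exact: dterm_comap. Qed.
Lemma dterm_add k (t u : pt M k -> M) : dterm t -> dterm u -> dterm (fun x => t x + u x).
Proof.
move=> /dterm_weaken dt /dterm_weaken du.
apply: def_ext (def_comp (def_add hS)
  (dmap_snoc (dmap_snoc (dmap_snoc (@dmap_nil _) dt) du) (dterm_var ord_max))) => z.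
rewrite /= snoc_max.
have -> : inord 1 = widen_ord (leqnSn 2) ord_max by apply: val_inj; rewrite /= inordK.
have -> : ord0 = widen_ord (leqnSn 2) (widen_ord (leqnSn 1) ord_max) by apply: val_inj.
by rewrite !snoc_widen !snoc_max.
Qed.
Lemma dterm_opp k (t : pt M k -> M) : dterm t -> dterm (fun x => - t x).
Proof.
move=> /dterm_weaken dt.
apply: def_ext (def_eq2 (dterm_add (dterm_var ord_max) dt) (dterm_cst _ 0)) => z /=.
by split=> [/eqP|->]; rewrite ?addNr // addr_eq0 => /eqP.
Qed.
End Definability.

(* Decides definability of a formula whose atoms are comparisons of definable terms or
   predicates assumed definable in the context. *)
Ltac dfn hG hS :=
  cbv beta;
  lazymatch goal with
  | |- dmap _ (fun x => snoc (@?t x) (@?u x)) => apply: (dmap_snoc (t := t) (u := u)); dfn hG hS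
  | |- dmap _ (fun x => catp (@?t x) (@?u x)) => apply: (dmap_catp (t := t) (u := u)); dfn hG hS
  | |- dmap _ _ => first [ assumption | let i := fresh "i" in move=> i; dfn hG hS ]
  | |- dterm _ (fun x => @GRing.add _ (@?t x) (@?u x)) => apply: (dterm_add hS (t := t) (u := u)); dfn hG hS
  | |- dterm _ (fun x => - (@?t x)) => apply: (dterm_opp hS (t := t)); dfn hG hS
  | |- dterm _ _ =>
    first [ assumption | exact: (dterm_cst hS) | exact: (dterm_var hS)
          | match goal with
            | H : dterm _ ?u |- dterm _ (fun x => ?u (@?t x)) =>
              apply: (dterm_comp hS H (t := t)); dfn hG hS
            | H : dmap _ ?u |- dterm _ (fun x => ?u (@?t x) ?i) =>
              apply: (dterm_comp hS (H i) (t := t)); dfn hG hS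
            | H : context [?u] |- dterm _ (fun x => ?u _) => apply: H; dfn hG hS
            | H : context [?u] |- dterm _ (fun x => ?u _ _) => apply: H; dfn hG hS
            end ]
  | |- _ (fun x => (@?A x) /\ (@?B x)) => apply: (def_and hS (A := A) (B := B)); dfn hG hS
  | |- _ (fun x => (@?A x) \/ (@?B x)) => apply: (def_or hS (A := A) (B := B)); dfn hG hS
  | |- _ (fun x => ~ (@?A x)) => apply: (def_not hS (A := A)); dfn hG hS
  | |- _ (fun x => (@?A x) -> (@?B x)) => apply: (def_imp hS (A := A) (B := B)); dfn hG hS
  | |- _ (fun x => exists y : pt _ _, @?A x y) => apply: (def_exv hS (A := A)); dfn hG hS
  | |- _ (fun x => exists y, @?A x y) => apply: (def_ex hS (A := A)); dfn hG hS
  | |- _ (fun x => forall y : pt _ _, @?A x y) => apply: (def_allv hS (A := A)); dfn hG hS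
  | |- _ (fun x => forall i : 'I__, @?A x i) => apply: (def_alli hS (A := A)) => ?; dfn hG hS
  | |- _ (fun x => forall y, @?A x y) => apply: (def_all hS (A := A)); dfn hG hS
  | |- _ (fun x => is_true (le _ _ _)) => apply: (def_le2 hG hS); dfn hG hS
  | |- _ (fun x => @eq _ _ _) => apply: (def_eq2 hS); dfn hG hS
  | |- _ (fun x => near _ _ _ _) => rewrite /near; dfn hG hS
  | |- _ => first
    [ assumption | exact: (def_cst hS)
    | apply: (def_lt2 hS); dfn hG hS
    | match goal with
      | H : _ ?A |- _ (fun x => ?A (@?t x)) => apply: (def_comp hS H (t := t)); dfn hG hS
      | H : context [?A] |- _ (fun x => ?A _) => apply: H; dfn hG hS
      | H : context [?A] |- _ (fun x => ?A _ _) => apply: H; dfn hG hS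
      | H : context [?A] |- _ (fun x => ?A _ _ _) => apply: H; dfn hG hS
      end ]
  end.


(** * One-sided germs *)

Section Germs.
Variables (M : Type) (R : rel M).
Hypotheses (Rxx : irreflexive R) (Rtr : transitive R)
  (Rtot : forall x y, [\/ R x y, x = y | R y x]) (Rsup : forall x, exists y, R x y).

(** Holds on an initial segment beyond [a] in the direction of [R]. Taking [R] to be the order or
    its reverse treats both sides of [a] at once. *)
Definition ev (a : M) (Y : M -> Prop) : Prop :=
  exists c, R a c /\ forall y, R a y -> R y c -> Y y.
Definition germ a Y := ev a Y \/ ev a (fun y => ~ Y y).

Lemma evT a (Y : M -> Prop) : (forall y, R a y -> Y y) -> ev a Y.
Proof. by move=> h; have [c ac] := Rsup a; exists c; split=> // y /h. Qed.
Lemma ev_impl a (Y Z : M -> Prop) : (forall y, R a y -> Y y -> Z y) -> ev a Y -> ev a Z.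
Proof. by move=> h [c [ac hc]]; exists c; split=> // y ay /(hc _ ay) /(h _ ay). Qed.
Lemma ev_and a (Y Z : M -> Prop) : ev a Y -> ev a Z -> ev a (fun y => Y y /\ Z y).
Proof.
move=> [c [ac hc]] [d [ad hd]]; have [cd|E|dc] := Rtot c d.
- by exists c; split=> // y ay yc; split; [apply: hc|apply: hd => //; apply: Rtr cd].
- by subst d; exists c; split=> // y ay yc; split; [apply: hc|apply: hd].
- by exists d; split=> // y ay yc; split; [apply: hc => //; apply: Rtr dc|apply: hd].
Qed.
Lemma germ_and a Y Z : germ a Y -> germ a Z -> germ a (fun y => Y y /\ Z y).
Proof.
move=> [hY|nY]; last by right; apply: ev_impl nY => y _ n [].
by move=> [hZ|nZ]; [left; apply: ev_and|right; apply: ev_impl nZ => y _ n []].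
Qed.
Lemma germ_not a Y : germ a Y -> germ a (fun y => ~ Y y).
Proof. by move=> [h|h]; [right; apply: ev_impl h => y _ ? []|left]. Qed.
Lemma germ_ext a (Y Z : M -> Prop) : (forall y, Y y <-> Z y) -> germ a Y -> germ a Z.
Proof.
move=> h [e|e]; [left|right]; apply: ev_impl e => y _; first by move/h.
by move=> n /h.
Qed.
Lemma germ_or a Y Z : germ a Y -> germ a Z -> germ a (fun y => Y y \/ Z y).
Proof.
move=> gY gZ; apply: germ_ext (germ_not (germ_and (germ_not gY) (germ_not gZ))) => y.
split=> [h|[h|h] [n1 n2] //].
by have [hY|nY] := pselect (Y y); [left|right; apply: contrapT => nZ; apply: h].
Qed.
Lemma germT a : germ a (fun _ => True).
Proof. by left; apply: evT. Qed.
Lemma germF a : germ a (fun _ => False).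
Proof. by right; apply: evT => y _ []. Qed.
Lemma germ_gt a u : germ a (fun y => R u y).
Proof.
have [ua|->|au] := Rtot u a.
- by left; apply: evT => y; apply: Rtr.
- by left; apply: evT.
- by right; exists u; split=> // y _ yu uy; have := Rtr yu uy; rewrite Rxx.
Qed.
Lemma germ_lt a u : germ a (fun y => R y u).
Proof.
have [ua|->|au] := Rtot u a.
- by right; apply: evT => y ay yu; have := Rtr (Rtr ay yu) ua; rewrite Rxx.
- by right; apply: evT => y ay yu; have := Rtr ay yu; rewrite Rxx.
- by left; exists u.
Qed.
Lemma germ_eq a u : germ a (fun y => u = y).
Proof.
apply: germ_ext (germ_and (germ_not (germ_gt a u)) (germ_not (germ_lt a u))) => y.
by split=> [[n1 n2]|->]; [case: (Rtot u y)|rewrite Rxx].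
Qed.
End Germs.

(** * Local o-minimality in the densely ordered case *)

Section Structure.
Variables (M : zmodType) (lt : rel M) (Def : forall k, set (pt M k) -> Prop).
Hypothesis hG : ordered_abelian_group lt.
Hypothesis hS : structure_on lt Def.
Hypothesis hC : def_complete lt Def.
Hypothesis hL : loc_omin lt Def.
Variable one : M.
Hypothesis one_gt0 : lt 0 one.
Hypothesis dense0 : forall e, lt 0 e -> exists2 v, lt 0 v & lt v e.
Local Notation le := (le lt).
Local Notation near := (near lt).
Local Notation dterm := (dterm Def).
Local Notation dmap := (dmap Def).

Let gt : rel M := fun x y => lt y x.

Lemma dense x y : lt x y -> exists2 z, lt x z & lt z y.
Proof.
move=> xy; have [|v v0 ve] := @dense0 (y - x); first by lin hG xy.
by exists (x + v); [lin hG v0|lin hG ve].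
Qed.

Lemma exists_half e : lt 0 e -> exists2 v, lt 0 v & le (v + v) e.
Proof.
move=> /dense0[u u0 ue].
have [|v [v0 vu ve]] := @exists_min_pos _ _ hG u (e - u) u0; first by lin hG ue.
by exists v => //; lin hG vu ve.
Qed.

(** Near [a] the set is a finite union of points and intervals. Each of these is eventually full or
    eventually empty on the chosen side, and this property survives boolean combinations. *)
Lemma germ_loc (R : rel M) (Y : M -> Prop) a : R = lt \/ R = gt ->
  Def (fun x : pt M 1 => Y (x ord0)) -> germ R a Y.
Proof.
have [irr tr tot _] := hG; move=> hR dY.
have Rxx : irreflexive R by case: hR => -> x; apply: irr.
have Rtr : transitive R.
  by case: hR => ->; [exact: tr|move=> y x z xy yz; apply: tr yz xy].
have Rtot x y : [\/ R x y, x = y | R y x].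
  by case: hR => -> //; rewrite /gt; case: (tot x y); [constructor 3|constructor 2|constructor 1].
have Rsup x : exists y, R x y.
  by case: hR => ->; [exists (x + one)|exists (x - one)]; rewrite /gt; lin hG one_gt0.
have germi u v : germ R a (itv lt u v).
  apply: germ_and => //.
    case: u => [u|]; last exact: germT.
    by case: hR => E; subst R; [apply: germ_gt|apply: (@germ_lt _ gt)].
  case: v => [v|]; last exact: germT.
  by case: hR => E; subst R; [apply: germ_lt|apply: (@germ_gt _ gt)].
have [b [c [abc [pts [ivs h]]]]] := hL dY a.
have gX : germ R a (fun y => Y y /\ itv lt b c y).
  apply: germ_ext (fun y => iff_sym (h y)) _; apply: germ_or => //.
    elim: pts {h} => [|p s IH]; first exact: germF.
    by apply: germ_or => //; apply: germ_eq.
  elim: ivs {h} => [|p s IH].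
    by apply: germ_ext (germF Rsup a) => y; split=> // -[? []].
  apply: germ_ext (germ_or Rtr Rtot (germi p.1 p.2) IH) => y.
  split=> [[h|[iv [h1 h2]]]|[iv [/= [<-|h1] h2]]]; [exists p|exists iv|left|right; exists iv] => //.
    by split=> //; left.
  by split=> //; right.
(* The neighborhood of [a] itself is eventually full, so intersecting with it does not change the
   germ. *)
have ei : ev R a (itv lt b c).
  have [ab ac] := abc; apply: ev_and => //.
    case: b ab {h gX abc} => [b|] ab; last exact: evT.
    by case: hR => E; subst R; [apply: evT => // y; exact: tr|exists b].
  case: c ac {h gX abc} => [c|] ac; last exact: evT.
  by case: hR => E; subst R; [exists c|apply: evT => // y ya; exact: tr ya ac].
case: gX => [e|e]; [left|right].
  by apply: ev_impl e => y _ [].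
by apply: ev_impl (ev_and Rtr Rtot e ei) => y _ [n i] Yy; apply: n.
Qed.


(** * Definable choice *)

(** Definability is required under all substitutions of definable terms, the form in which [dfn] can
    use it at any occurrence of [R]. *)
Definition drel k (R : pt M k -> M -> Prop) : Prop :=
  forall n t u, dmap t -> dterm u -> Def (fun x : pt M n => R (t x) (u x)).
Definition dvrel k l (R : pt M k -> pt M l -> Prop) : Prop :=
  forall n t u, dmap t -> dmap u -> Def (fun x : pt M n => R (t x) (u x)).

Lemma def_description k (R : pt M k -> M -> Prop) :
  drel R -> (forall x u v, R x u -> R x v -> u = v) ->
  exists2 F, dterm F & forall x, (exists u, R x u) -> R x (F x).
Proof.
move=> dR uR.
(* The value 0 where no witness exists keeps the graph of the total function definable. *)
pose F x := if pselect (exists u, R x u) is left h then projT1 (cid h) else 0.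
have FR x : (exists u, R x u) -> R x (F x).
  by rewrite /F; case: pselect => // h _; case: (cid h).
exists F => //; change (Def (fun z : pt M k.+1 => z ord_max = F (init z))).
have : Def (fun z : pt M k.+1 => R (init z) (z ord_max) \/
    ~ (exists u, R (init z) u) /\ z ord_max = 0) by dfn hG hS.
apply: (def_ext (Def := Def)) => z; split=> [[h|[n ->]]|->].
- exact: uR h (FR _ (ex_intro _ _ h)).
- by rewrite /F; case: pselect.
have [h|n] := pselect (exists u, R (init z) u); [by left; apply: FR|right; split=> //].
by rewrite /F; case: pselect.
Qed.

Lemma double_inj (u v : M) : u + u = v + v -> u = v.
Proof.
move=> E; case: (ltP hG u v) => // h; have := ltD hG h h; rewrite E; by rewrite ltxx.
Qed.

(** The half is the supremum of the [x] with [x + x] at most [w]. If its double missed [w], shifting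
    it by a small [v] would contradict that it is the least upper bound. *)
Lemma halvable w : lt 0 w -> exists h, h + h = w.
Proof.
move=> w0.
have dX : Def (fun x : pt M 1 => le (x ord0 + x ord0) w) by dfn hG hS.
have [|hsup _] := hC (X := fun x => le (x + x) w) dX.
  by exists 0; rewrite addr0; apply: leW.
have [|h [ub lub]] := hsup.
  exists w => x xw; apply/(nltE hG) => wx; apply: (lt_le_false hG w0).
  by lin hG xw wx wx.
exists h; case: (ltP hG (h + h) w) => // hw; exfalso.
  have [|v v0 vh] := @exists_half (w - (h + h)); first by lin hG hw.
  have /ub l : le ((h + v) + (h + v)) w by lin hG vh.
  by apply: (lt_le_false hG v0); lin hG l.
have [|v v0 vh] := @exists_half ((h + h) - w); first by lin hG hw.
have /lub l : forall x, le (x + x) w -> le x (h - v).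
  by move=> x xw; apply/(nltE hG) => hx; have : lt x x; [lin hG xw hx hx vh|rewrite ltxx].
by apply: (lt_le_false hG v0); lin hG l.
Qed.

Definition is_inf (B : M -> Prop) (s : M) : Prop :=
  (forall z, B z -> le s z) /\ forall t, (forall z, B z -> le t z) -> le t s.

Lemma is_inf_uniq B s t : is_inf B s -> is_inf B t -> s = t.
Proof.
move=> [s1 s2] [t1 t2]; case: (ltP hG s t) => // h; exfalso.
  exact: (lt_le_false hG h (s2 _ t1)).
exact: (lt_le_false hG h (t2 _ s1)).
Qed.

(** Otherwise the germ of [B] to the right of [s] is empty, and a larger lower bound exists. *)
Lemma ev_above_inf B s : Def (fun x : pt M 1 => B (x ord0)) -> is_inf B s -> ~ B s -> ev lt s B.
Proof.
move=> dB [lb glb] nBs.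
have [//|[c [sc hc]]] := germ_loc s (or_introl erefl) dB.
exfalso; apply: (lt_le_false hG sc); apply: glb => z Bz.
apply/(nltE hG) => zc; apply: (hc z _ zc Bz).
by move: (lb _ Bz) => /orP[//|/eqP E]; case: nBs; rewrite E.
Qed.

(** Here [c] is the right end of the longest interval of [B] starting at [s]; maximality determines
    it uniquely. *)
Definition gap_above (B : M -> Prop) s c : Prop :=
  lt s c /\ (forall z, lt s z -> lt z c -> B z) /\
  forall c', lt c c' -> ~ forall z, lt s z -> lt z c' -> B z.

(* The least element if there is one, else a point of the first interval:
   its midpoint, or [inf + one] when it is unbounded. *)
Definition canonical_point (B : M -> Prop) (u : M) : Prop :=
  exists s, is_inf B s /\ (B s /\ u = s \/ ~ B s /\
    ((forall z, lt s z -> B z) /\ u = s + one \/ exists c, gap_above B s c /\ u + u = s + c)).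

Lemma canonical_point_mem B u : canonical_point B u -> B u.
Proof.
move=> [s [_ [[bs ->] //|[_ [[h ->]|[c [[sc [h _]] E]]]]]]].
  by apply: h; lin hG one_gt0.
apply: h; apply: contrapT => /(nltE hG) l; apply: (lt_le_false hG sc);
  by have := leD hG l l; rewrite E => h1; lin hG h1.
Qed.

Lemma canonical_point_uniq B u v : canonical_point B u -> canonical_point B v -> u = v.
Proof.
move=> [s [is_ hs]] [t [/(is_inf_uniq is_) <-]].
case: hs => [[bs ->]|[nbs hs]] [[bt ->]|[nbt ht]] //.
case: hs ht => [[h ->]|[c [[sc [h1 h2]] E]]] [[k ->]|[d [[sd [k1 k2]] F]]] //.
- by case: (k2 (d + one)); [lin hG one_gt0|move=> z sz _; apply: h].
- by case: (h2 (c + one)); [lin hG one_gt0|move=> z sz _; apply: k].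
apply: double_inj; rewrite E F; case: (ltP hG c d) => [cd|->|dc] //.
  by case: (h2 d).
by case: (k2 c).
Qed.

(** Nonnegativity of [B] provides the infimum, and makes [s + d] positive so that the midpoint
    exists by [halvable]. *)
Lemma canonical_point_ex (B : M -> Prop) : Def (fun x : pt M 1 => B (x ord0)) ->
  (forall u, B u -> le 0 u) -> (exists u, B u) -> exists u, canonical_point B u.
Proof.
move=> dB B0 neB.
have [_ /(_ (ex_intro _ 0 B0)) [s is_]] := hC dB neB.
have [bs|nbs] := pselect (B s); first by exists s, s; split=> //; left.
have [c [sc hc]] := ev_above_inf dB is_ nbs.
(* The supremum of these right ends, if finite, is the end of the longest interval. *)
pose E c := lt s c /\ forall z, lt s z -> lt z c -> B z.
have dE : Def (fun x : pt M 1 => E (x ord0)).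
  have dB' k (t : pt M k -> M) : dterm t -> Def (fun x => B (t x)) by move=> dt; apply: (def_rel1 hS).
  by rewrite /E; dfn hG hS.
have [hsup _] := hC dE (ex_intro _ c (conj sc hc)).
have [bE|nbE] := pselect (exists b, forall x, E x -> le x b).
  have [d [ub lub]] := hsup bE.
  have sd : lt s d by apply: (lt_le_tr hG sc); apply: ub.
  have gap : gap_above B s d.
    split=> //; split=> [z sz zd|c' dc' hc'].
      apply: contrapT => nBz; apply: (lt_le_false hG zd); apply: lub => x [sx hx].
      by apply/(nltE hG) => zx; apply/nBz/hx.
    by apply: (lt_le_false hG dc'); apply: ub; split=> //; apply: (lt_tr hG) sd dc'.
  have [|h hh] := @halvable (s + d).
    have s0 : le 0 s by case: is_ => _; apply.
    by lin hG sd s0 s0.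
  by exists h, s; split=> //; right; split=> //; right; exists d.
exists (s + one), s; split=> //; right; split=> //; left; split=> // z sz.
apply: contrapT => nBz; apply: nbE; exists z => x [sx hx].
by apply/(nltE hG) => zx; apply/nBz/hx.
Qed.

Lemma drel_fib k (R : pt M k -> M -> Prop) x : drel R -> Def (fun y : pt M 1 => R x (y ord0)).
Proof. by move=> dR; dfn hG hS. Qed.

Lemma def_choice k (R : pt M k -> M -> Prop) : drel R ->
  exists2 F, dterm F & forall x, (exists u, R x u) -> R x (F x).
Proof.
(* Each fiber is folded onto the nonnegative half-line, where a canonical point exists; [G] restores
   the sign afterwards. *)
move=> dR; pose B x u := le 0 u /\ (R x u \/ R x (- u)).
have dB : drel B by move=> n t u dt du; rewrite /B; dfn hG hS.
have [|x u v|F dF hF] := @def_description k (fun x => canonical_point (B x)).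
- move=> n t u dt du; rewrite /canonical_point /is_inf /gap_above; dfn hG hS.
- exact: canonical_point_uniq.
have [|x u v|G dG hG'] := @def_description k (fun x u => R x (F x) /\ u = F x \/
    ~ R x (F x) /\ u = - F x).
- by move=> n t u dt du; dfn hG hS.
- by move=> [[h ->]|[h ->]] [[h' ->]|[h' ->]].
exists G => // x neR.
have BF : B x (F x).
  apply: canonical_point_mem; apply: hF; apply: canonical_point_ex; first exact: drel_fib.
    by move=> u [].
  have [u hu] := neR; case: (le_or_lt hG 0 u) => hu0.
    by exists u; split=> //; left.
  by exists (- u); split; [lin hG hu0|right; rewrite opprK].
have : exists u, R x (F x) /\ u = F x \/ ~ R x (F x) /\ u = - F x.
  by have [h|h] := pselect (R x (F x)); eexists; [left|right]; split.
by move=> /hG'[[h ->]|[h ->]] //; case: BF => _ [].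
Qed.

Lemma def_choicev k l (R : pt M k -> pt M l -> Prop) : dvrel R ->
  exists2 F, dmap F & forall x, (exists u, R x u) -> R x (F x).
Proof.
elim: l R => [|l IH] R dR.
  exists (fun _ _ => 0); first exact: dmap_nil.
  by move=> x [u]; rewrite [u](pt0_eq _ (fun _ => 0)).
have [|F dF hF] := IH (fun x y => exists u, R x (snoc y u)).
  by move=> n t u dt du; dfn hG hS.
have [|G dG hG'] := @def_choice k (fun x u => R x (snoc (F x) u)).
  by move=> n t u dt du; dfn hG hS.
exists (fun x => snoc (F x) (G x)); first exact: dmap_snoc.
move=> x [u hu]; apply: hG'; apply: hF.
by exists (init u), (u ord_max); rewrite snoc_init.
Qed.


(** * Definable sets and functions on intervals *)

Definition dset1 (X : M -> Prop) : Prop :=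
  forall k (t : pt M k -> M), dterm t -> Def (fun x => X (t x)).
Definition dterm1 (g : M -> M) : Prop :=
  forall k (t : pt M k -> M), dterm t -> dterm (fun x => g (t x)).

Lemma dset1_def X : dset1 X -> Def (fun x : pt M 1 => X (x ord0)).
Proof. by apply; apply: (dterm_var hS). Qed.

Lemma near_subinterval a b : lt a b ->
  exists c r, lt 0 r /\ forall u, near r c u -> lt a u /\ lt u b.
Proof.
move=> /dense[c ac cb].
have [||r [r0 ra rb]] := @exists_min_pos _ _ hG (c - a) (b - c); first by lin hG ac.
  by lin hG cb.
by exists c, r; split=> // u [h1 h2]; split; [lin hG h1 ra|lin hG h2 rb].
Qed.

Lemma ev_subinterval a b (Y : M -> Prop) : ev lt a Y -> lt a b ->
  exists c r, lt 0 r /\ forall u, near r c u -> [/\ lt a u, lt u b & Y u].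
Proof.
move=> [c [ac h]] ab; have [d [dc db dE]] := exists_min hG c b.
have ad : lt a d by case: dE => ->.
have [e [r [r0 her]]] := near_subinterval ad; exists e, r; split=> // u /her[au ud].
by split=> //; [apply: lt_le_tr ud db|apply: h => //; apply: lt_le_tr ud dc].
Qed.

Lemma near_right r z u : lt 0 r -> lt z u -> lt u (z + r) -> near r z u.
Proof. by move=> r0 zu uz; split=> //; lin hG r0 zu. Qed.

Lemma subinterval_dichotomy X z r : dset1 X -> lt 0 r -> exists c s,
  [/\ lt 0 s, forall u, near s c u -> near r z u &
      (forall u, near s c u -> X u) \/ (forall u, near s c u -> ~ X u)].
Proof.
move=> dX r0; have zr : lt z (z + r) by lin hG r0.
case: (germ_loc z (or_introl erefl) (dset1_def dX)) => /ev_subinterval/(_ zr)[c [s [s0 h]]];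
  (exists c, s; split=> // [u /h[zu ur _]|]; first exact: near_right).
  by left=> u /h[].
by right=> u /h[].
Qed.

(* If no superlevel set of [g] had interior, the set of running records of [g] to the right of
   [z] would accumulate at [z], hence contain an interval, on which [g] increases. *)
Lemma superlevel_interior g z r : dterm1 g -> lt 0 r -> exists x0, near r z x0 /\
  exists c s, lt 0 s /\ forall u, near s c u -> near r z u /\ le (g x0) (g u).
Proof.
move=> dg r0; apply: contrapT => N.
have {}N x0 c s : near r z x0 -> lt 0 s ->
    ~ forall u, near s c u -> near r z u /\ le (g x0) (g u).
  by move=> zx s0 h; apply: N; exists x0; split=> //; exists c, s.
pose X x := lt z x /\ forall y, lt z y -> lt y x -> lt (g y) (g x).
have zr : lt z (z + r) by lin hG r0.
(* Take the infimum [s] of the points of [(z, x']] where [g] is at least [g x']. If attained, [s] is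
   a record; if not, such points fill an interval to the right of [s], against [N]. *)
have record x' : lt z x' -> lt x' (z + r) -> exists x, X x /\ le x x'.
  move=> zx' x'r; pose S u := lt z u /\ le u x' /\ le (g x') (g u).
  have dS : Def (fun x : pt M 1 => S (x ord0)) by rewrite /S; dfn hG hS.
  have Sx' : S x' by split=> //; split; apply: lexx.
  have [_ []] := hC dS (ex_intro _ x' Sx').
    by exists z => x [zx _]; apply: leW.
  move=> s is_; have [[zs [sx' gs]]|nSs] := pselect (S s).
    exists s; split=> //; split=> // y zy ys; apply: (lt_le_tr hG) gs.
    apply/(nleE hG) => gy; case: is_ => lb _; apply: (lt_le_false hG ys); apply: lb.
    by split=> //; split=> //; apply: leW; apply: (lt_le_tr hG) ys sx'.
  have sx : lt s x' by case: is_ => lb _; case/orP: (lb _ Sx') => // /eqP E; case: nSs; rewrite E.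
  have [c [t [t0 h]]] := ev_subinterval (ev_above_inf dS is_ nSs) sx.
  have := N x' c t (near_right r0 zx' x'r) t0; case=> u /h[_ ux' [zu [_ gu]]].
  by split=> //; apply: near_right => //; apply: lt_tr ux' x'r.
have dX : Def (fun x : pt M 1 => X (x ord0)) by rewrite /X; dfn hG hS.
have [eX|nX] := germ_loc z (or_introl erefl) dX; last first.
  have [c [zc hc]] := nX; have [d [dc dr dE]] := exists_min hG c (z + r).
  have [x' zx' x'd] : exists2 x', lt z x' & lt x' d by apply: dense; case: dE => ->.
  have [x [Xx xx']] := record x' zx' (lt_le_tr hG x'd dr).
  apply: (hc x) => //; first by case: Xx.
  by apply: le_lt_tr xx' _ => //; apply: lt_le_tr x'd dc.
(* Records now fill an interval at [z]. To the right of a point [x0] in it, [g] stays above [g x0],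
   against [N]. *)
have [c [zc hc]] := eX; have [d [dc dr dE]] := exists_min hG c (z + r).
have [x0 zx0 x0d] : exists2 x', lt z x' & lt x' d by apply: dense; case: dE => ->.
have [e [t [t0 h]]] := near_subinterval x0d.
have := N x0 e t (near_right r0 zx0 (lt_le_tr hG x0d dr)) t0; case=> u /h[x0u ud].
have zu := lt_tr hG zx0 x0u; have [_ hX] := hc u zu (lt_le_tr hG ud dc).
by split; [apply: near_right => //; apply: lt_le_tr ud dr|apply/leW/hX].
Qed.

(** After shrinking to an interval where [g] is bounded, let [s] be its limit inferior at [a] from
    the right. The germ of [lt (s + v) (g u)] cannot be full, so [g] eventually lies between [s - v]
    and [s + v]. *)
Lemma subinterval_small_oscillation g z r e : dterm1 g -> lt 0 r -> lt 0 e -> exists c s,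
  [/\ lt 0 s, forall u, near s c u -> near r z u &
      forall u v, near s c u -> near s c v -> near e (g u) (g v)].
Proof.
move=> dg r0 e0.
(* Superlevel sets of [g], then of its opposite inside the interval found, give a lower and an upper
   bound. *)
have [x1 [_ [c1 [r1 [r10 h1]]]]] := superlevel_interior z dg r0.
have dgN : dterm1 (fun x => - g x) by move=> k t dt; dfn hG hS.
have [x2 [_ [a [r2 [r20 h2]]]]] := superlevel_interior c1 dgN r10.
have {dgN h1 x1 h2 x2 c1 r1 r10} [A [B h]] : exists A B, forall u, near r2 a u ->
    [/\ near r z u, le A (g u) & le (g u) B].
  by exists (g x1), (g x2) => u /h2[/h1[? ?] l]; split=> //; lin hG l.
have ar : lt a (a + r2) by lin hG r20.
pose T t := exists c, lt a c /\ forall u, lt a u -> lt u c -> lt t (g u).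
have dT : Def (fun x : pt M 1 => T (x ord0)) by rewrite /T; dfn hG hS.
have neT : exists t, T t.
  exists (A - one), (a + r2); split=> // u au ur; have [_ l _] := h u (near_right r20 au ur).
  by lin hG l one_gt0.
have [hsup _] := hC dT neT; have [|s [ub lub]] := hsup.
  exists B => t /ev_subinterval/(_ ar)[c [p [p0 hp]]].
  have [au ur l] := hp c (near_refl hG c p0).
  by have [_ _ l2] := h c (near_right r20 au ur); apply: leW; apply: lt_le_tr l l2.
have [v v0 ve] := exists_half e0.
have low : ev lt a (fun u => lt (s - v) (g u)).
  have [t [Tt st]] : exists t, T t /\ lt (s - v) t.
    apply: contrapT => n; have : le s (s - v).
      by apply: lub => t Tt; apply/(nltE hG) => l; apply: n; exists t.
    by move=> l; apply: (lt_le_false hG v0); lin hG l.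
  by apply: ev_impl Tt => u _; apply: lt_tr st.
have dY : Def (fun x : pt M 1 => lt (s + v) (g (x ord0))) by dfn hG hS.
have [up|up] := germ_loc (Y := fun u => lt (s + v) (g u)) a (or_introl erefl) dY.
  by have l := ub _ up; exfalso; apply: (lt_le_false hG v0); lin hG l.
have [_ tr tot _] := hG.
have [c [p [p0 hp]]] := ev_subinterval (ev_and tr tot low up) ar.
exists c, p; split=> // [u /hp[au ur _]|u w /hp[_ _ [ul /(nltE hG) uu]] /hp[_ _ [wl /(nltE hG) wu]]].
  by have [] := h u (near_right r20 au ur).
by split; [lin hG uu wl ve|lin hG wu ul ve].
Qed.

(** * Definable sets and functions on balls *)

Definition ball k (z : pt M k) (r : M) (y : pt M k) : Prop := forall i, near r (z i) (y i).

Definition refine k (z : pt M k) (r : M) (Q : pt M k -> M -> Prop) : Prop :=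
  exists z' r', [/\ lt 0 r', forall y, ball z' r' y -> ball z r y & Q z' r'].

Definition ball_dichotomy k : Prop := forall (X : pt M k -> Prop) z r, Def X -> lt 0 r ->
  refine z r (fun z' r' => (forall y, ball z' r' y -> X y) \/ (forall y, ball z' r' y -> ~ X y)).
Definition ball_lower_bound k : Prop := forall (g : pt M k -> M) z r, dterm g -> lt 0 r ->
  (forall y, ball z r y -> lt 0 (g y)) ->
  refine z r (fun z' r' => exists2 e, lt 0 e & forall y, ball z' r' y -> le e (g y)).
Definition ball_small_oscillation k : Prop := forall (g : pt M k -> M) z r e,
  dterm g -> lt 0 r -> lt 0 e ->
  refine z r (fun z' r' => forall y y', ball z' r' y -> ball z' r' y' -> near e (g y) (g y')).

Lemma ball_center k (z : pt M k) r : lt 0 r -> ball z r z.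
Proof. by move=> r0 i; apply: near_refl. Qed.

Lemma ball_snoc k (z : pt M k) c r s t (w : pt M k.+1) : le t r -> le t s ->
  ball (snoc z c) t w -> ball z r (init w) /\ near s c (w ord_max).
Proof.
move=> tr ts h; split=> [i|].
  by move: (h (widen_ord (leqnSn k) i)); rewrite snoc_widen; apply: near_le.
by move: (h ord_max); rewrite snoc_max; apply: near_le.
Qed.

Lemma ball_init k (z : pt M k.+1) r w :
  ball (init z) r (init w) -> near r (z ord_max) (w ord_max) -> ball z r w.
Proof. by move=> h1 h2 i; case: (ord_maxVwiden i) => [->|[j ->]]; last exact: h1. Qed.

Section Step.
Variable k : nat.
Hypothesis Lk : ball_lower_bound k.
Hypothesis Wk : ball_small_oscillation k.

(** Choose the radius [s y] and the center [c y] definably. On a smaller ball [s] is at least [e]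
    and [c] varies by less than [v], a half of [e] or less, so the interval of radius [v] about
    [c z2] fits into all of them. *)
Lemma refine_uniform_interval (R : pt M k -> M -> M -> Prop) z r :
  (forall n t u v, dmap t -> dterm u -> dterm v -> Def (fun x : pt M n => R (t x) (u x) (v x))) ->
  (forall y c s c' s', R y c s -> lt 0 s' -> (forall u, near s' c' u -> near s c u) -> R y c' s') ->
  lt 0 r -> (forall y, ball z r y -> exists c s, lt 0 s /\ R y c s) ->
  refine z r (fun z' r' => exists c s, lt 0 s /\ forall y, ball z' r' y -> R y c s).
Proof.
move=> dR mono r0 h.
have [|s ds hs] := @def_choice k (fun y s => lt 0 s /\ exists c, R y c s).
  by move=> n t u dt du; dfn hG hS.
have [|c dc hc] := @def_choice k (fun y c => R y c (s y)).
  by move=> n t u dt du; dfn hG hS.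
have {hs}hs y : ball z r y -> lt 0 (s y) /\ exists c, R y c (s y).
  by move=> /h[b [p [p0 hp]]]; apply: hs; exists p; split=> //; exists b.
have [z1 [r1 [r10 sub1 [e e0 he]]]] := Lk ds r0 (fun y b => proj1 (hs y b)).
have [v v0 ve] := exists_half e0.
have [z2 [r2 [r20 sub2 hv]]] := Wk z1 dc r10 v0.
exists z2, r2; split=> //; first by move=> y /sub2/sub1.
exists (c z2), v; split=> // y yb.
have [s0 /hc Ry] := hs y (sub1 _ (sub2 _ yb)).
apply: mono Ry v0 _ => u un; apply: near_le (he _ (sub2 _ yb)) _ => //.
apply: near_le ve _ => //; apply: near_tr un => //.
by apply: hv => //; apply: ball_center.
Qed.

Lemma refine_fibers (A : pt M k.+1 -> Prop) z r : Def A -> lt 0 r ->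
  (forall y, ball z r y -> exists c s, lt 0 s /\ forall u, near s c u -> A (snoc y u)) ->
  exists z' r', lt 0 r' /\ forall w, ball z' r' w -> ball z r (init w) /\ A w.
Proof.
move=> dA r0 h.
have [||z' [r' [r'0 sub [c [s [s0 hcs]]]]]] := refine_uniform_interval (z := z)
  (R := fun y c s => forall u, near s c u -> A (snoc y u)) _ _ r0 h.
- by move=> n t u v dt du dv; dfn hG hS.
- by move=> y c s c' s' hR _ sub u /sub/hR.
have [t [t0 tr ts]] := exists_min_pos hG r'0 s0.
exists (snoc z' c), t; split=> // w /(ball_snoc tr ts)[b n]; split; first exact: sub.
by have := hcs _ b _ n; rewrite snoc_init.
Qed.

(** Dichotomy in dimension [k] is applied to the base points whose fiber of [X] contains an
    interval. On a ball without such points, every fiber of the complement contains an interval.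
    Either way the intervals assemble into a ball. *)
Lemma ball_dichotomyS : ball_dichotomy k -> ball_dichotomy k.+1.
Proof.
move=> Uk X z r dX r0.
pose I (Y : pt M k.+1 -> Prop) y := exists c s,
  lt 0 s /\ forall u, near s c u -> near r (z ord_max) u /\ Y (snoc y u).
have dI Y : Def Y -> Def (I Y) by move=> dY; rewrite /I; dfn hG hS.
have fin (Y : pt M k.+1 -> Prop) z1 r1 : Def Y -> lt 0 r1 ->
    (forall y, ball z1 r1 y -> ball (init z) r y) -> (forall y, ball z1 r1 y -> I Y y) ->
    refine z r (fun z' r' => forall w, ball z' r' w -> Y w).
  move=> dY r10 sub h.
  have [|//|y /h[c [s [s0 hs]]]|z2 [r2 [r20 h2]]] :=
    @refine_fibers (fun w => near r (z ord_max) (w ord_max) /\ Y w) z1 r1.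
  - by dfn hG hS.
  - by exists c, s; split=> // u; rewrite snoc_max; apply: hs.
  by exists z2, r2; split=> // w /h2[/sub b [n Yw]] //; apply: ball_init.
have [z1 [r1 [r10 sub1 [h|h]]]] := Uk _ (init z) r (dI X dX) r0.
  by have [z2 [r2 [r20 s2 h2]]] := fin X z1 r1 dX r10 sub1 h; exists z2, r2; split=> //; left.
have [y /h nI|z2 [r2 [r20 s2 h2]]] := fin (fun w => ~ X w) z1 r1 (def_not hS dX) r10 sub1; last first.
  by exists z2, r2; split=> //; right.
have [|c [s [s0 sub hs]]] := @subinterval_dichotomy (fun u => X (snoc y u)) (z ord_max) r _ r0.
  by move=> n t dt; dfn hG hS.
exists c, s; split=> // u un; split; first exact: sub.
case: hs => hs; last exact: hs.
by exfalso; apply: nI; exists c, s; split=> // v vn; split; [apply: sub|apply: hs].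
Qed.

(** In each fiber [g] is at least some positive [e y] on an interval; choosing [e] definably reduces
    the bound to dimension [k]. *)
Lemma ball_lower_boundS : ball_lower_bound k.+1.
Proof.
move=> g z r dg r0 gpos.
pose R y e c s := lt 0 e /\ lt 0 s /\
  forall u, near s c u -> near r (z ord_max) u /\ le e (g (snoc y u)).
have [|e de he] := @def_choice k (fun y e => exists c s, R y e c s).
  by move=> n t u dt du; rewrite /R; dfn hG hS.
have {}he y : ball (init z) r y -> exists c s, R y (e y) c s.
  move=> yb; apply: he.
  have [|x0 [n0 [c [s [s0 h]]]]] := @superlevel_interior (fun u => g (snoc y u)) (z ord_max) r _ r0.
    by move=> n t dt; dfn hG hS.
  exists (g (snoc y x0)), c, s; split=> //.
  by apply: gpos; apply: ball_init; rewrite ?init_snoc ?snoc_max.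
have [|z1 [r1 [r10 sub1 [a a0 ha]]]] := Lk (z := init z) de r0.
  by move=> y /he[c [s []]].
have [|//|y yb|z2 [r2 [r20 h2]]] :=
  @refine_fibers (fun w => near r (z ord_max) (w ord_max) /\ le a (g w)) z1 r1.
- by dfn hG hS.
- have [c [s [_ [s0 h]]]] := he _ (sub1 _ yb); exists c, s; split=> // u /h[n l].
  by rewrite snoc_max; split=> //; apply: le_tr (ha _ yb) l.
exists z2, r2; split=> // [w /h2[/sub1 b [n _]]|]; first exact: ball_init.
by exists a => // y /h2[_ []].
Qed.

Lemma ball_small_oscillationS : ball_small_oscillation k.+1.
Proof.
move=> g z r e dg r0 e0.
(* Two points are compared through the slice at height [c]: vertically, along the slice, vertically.
   Each move costs [b], and four times [b] is at most [e]. *)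
have [a a0 ae] := exists_half e0; have [b b0 ba] := exists_half a0.
pose R y c s := forall u v, near s c u -> near s c v ->
  near r (z ord_max) u /\ near b (g (snoc y u)) (g (snoc y v)).
have [||y yb|z1 [r1 [r10 sub1 [c [s [s0 h]]]]]] := refine_uniform_interval (z := init z) (R := R) _ _ r0.
- by move=> n t u v dt du dv; rewrite /R; dfn hG hS.
- by move=> y c s c' s' h _ sub u v /sub un /sub vn; apply: h.
- have [|c [s [s0 sub hs]]] :=
    @subinterval_small_oscillation (fun u => g (snoc y u)) (z ord_max) r b _ r0 b0.
    by move=> n t dt; dfn hG hS.
  by exists c, s; split=> // u v un vn; split; [apply: sub|apply: hs].
have [|z2 [r2 [r20 sub2 h2]]] := Wk (g := fun y => g (snoc y c)) z1 _ r10 b0.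
  by dfn hG hS.
have [t [t0 tr ts]] := exists_min_pos hG r20 s0.
have cn := near_refl hG c s0.
exists (snoc z2 c), t; split=> // [w /(ball_snoc tr ts)[/sub2 wb wn]|w w'].
  by apply: ball_init; [apply: sub1|have [] := h _ wb _ _ wn wn].
move=> /(ball_snoc tr ts)[wb wn] /(ball_snoc tr ts)[wb' wn'].
have [_ n1] := h _ (sub2 _ wb) _ _ wn cn; have [_ n3] := h _ (sub2 _ wb') _ _ cn wn'.
have n2 := h2 _ _ wb wb'; rewrite !snoc_init in n1 n3.
have l : le (b + b + b) e by lin hG ba ba b0 ae.
by apply: near_le l _ => //; apply: near_tr n3 => //; apply: near_tr n2.
Qed.
End Step.

Lemma ball_properties k :
  [/\ ball_dichotomy k, ball_lower_bound k & ball_small_oscillation k].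
Proof.
elim: k => [|k [U L W]]; last first.
  by split; [exact: ball_dichotomyS|exact: ball_lower_boundS|exact: ball_small_oscillationS].
split=> [X z r dX r0|g z r dg r0 h|g z r e dg r0 e0]; exists z, r; split=> //.
- by have [h|h] := pselect (X z); [left|right] => y _; rewrite [y](pt0_eq _ z).
- exists (g z); first by apply: h; apply: ball_center.
  by move=> y _; rewrite [y](pt0_eq _ z); apply: lexx.
- by move=> y y' _ _; rewrite [y](pt0_eq _ y'); apply: near_refl.
Qed.


Lemma refine_all k l (Q : 'I_l -> pt M k -> M -> Prop) z r :
  (forall i z r, lt 0 r -> refine z r (Q i)) ->
  (forall i z r z' r', Q i z r -> (forall y, ball z' r' y -> ball z r y) -> Q i z' r') ->
  lt 0 r -> refine z r (fun z' r' => forall i, Q i z' r').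
Proof.
move=> hQ mono r0.
have [z' [r' [r'0 sub h]]] : refine z r (fun z' r' => forall i, i \in enum 'I_l -> Q i z' r').
  elim: (enum _) => [|j s [z1 [r1 [r10 sub1 h1]]]]; first by exists z, r.
  have [z2 [r2 [r20 sub2 h2]]] := hQ j z1 r1 r10.
  exists z2, r2; split=> // [y /sub2/sub1 //|i].
  by rewrite in_cons => /orP[/eqP -> //|/h1 q]; apply: mono q sub2.
by exists z', r'; split=> // i; apply: h; rewrite mem_enum.
Qed.

Lemma exists_min_all l (T : 'I_l -> M -> Prop) :
  (forall i, exists2 r, lt 0 r & T i r) -> (forall i r r', T i r -> le r' r -> T i r') ->
  exists2 r, lt 0 r & forall i, T i r.
Proof.
move=> hT mono.
have [r r0 h] : exists2 r, lt 0 r & forall i, i \in enum 'I_l -> T i r.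
  elim: (enum _) => [|j s [r r0 h]]; first by exists one.
  have [r1 r10 h1] := hT j; have [t [t0 tr tr1]] := exists_min_pos hG r0 r10.
  exists t => // i; rewrite in_cons => /orP[/eqP ->|/h hi]; first exact: mono h1 tr1.
  exact: mono hi tr.
by exists r => // i; apply: h; rewrite mem_enum.
Qed.

Lemma refine_small_oscillation k l (g : pt M k -> pt M l) z r e :
  dmap g -> lt 0 r -> lt 0 e ->
  refine z r (fun z' r' => forall y y', ball z' r' y -> ball z' r' y' -> ball (g y) e (g y')).
Proof.
move=> dg r0 e0; have [_ _ W] := ball_properties k.
have [|i z1 r1 z2 r2 h sub|//|z' [r' [r'0 sub h]]] := @refine_all k l (fun i z' r' =>
    forall y y', ball z' r' y -> ball z' r' y' -> near e (g y i) (g y' i)) z r.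
- by move=> i z1 r1 r10; apply: W.
- by move=> y y' /sub b /sub b'; apply: h.
by exists z', r'; split=> // y y' b b' i; apply: h.
Qed.

Lemma ball_open k (z : pt M k) r y : ball z r y ->
  exists2 s, lt 0 s & forall y', ball y s y' -> ball z r y'.
Proof.
move=> yb.
have [i|i s s' h l|s s0 h] := @exists_min_all k (fun i s => forall u, near s (y i) u -> near r (z i) u).
- have [l1 l2] := yb i.
  have [||s [s0 s1 s2]] := @exists_min_pos _ _ hG (y i + r - z i) (z i + r - y i); first by lin hG l1.
    by lin hG l2.
  by exists s => // u [n1 n2]; split; [lin hG s1 n1|lin hG s2 n2].
- by move=> u /(near_le hG l); apply: h.
by exists s => // y' b i; apply: h.
Qed.

(** * Isolated points and fibers *)

(** Neither one-sided germ of [X] at [a] can be full, so both are empty. *)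
Lemma no_interior_isolated (X : M -> Prop) a : dset1 X ->
  (forall c s, lt 0 s -> ~ forall u, near s c u -> X u) ->
  exists2 r, lt 0 r & forall u, X u -> near r a u -> u = a.
Proof.
move=> /dset1_def dX N.
have [eX|[c [ac hc]]] := germ_loc a (or_introl erefl) dX.
  have ab : lt a (a + one) by lin hG one_gt0.
  have [c [s [s0 h]]] := ev_subinterval eX ab.
  by case: (N c s s0) => u /h[].
have [[d [da hd]]|[d [da hd]]] := germ_loc a (or_intror erefl) dX.
  have [e [s [s0 h]]] := near_subinterval da.
  by case: (N e s s0) => u /h[du ua]; apply: hd.
have [||r [r0 rc rd]] := @exists_min_pos _ _ hG (c - a) (a - d); first by lin hG ac.
  by rewrite /gt in da; lin hG da.
exists r => // u Xu [n1 n2]; case: (ltP hG a u) => // l; exfalso.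
  by apply: hc Xu => //; lin hG n2 rc.
by apply: hd Xu => //; rewrite /gt; lin hG n1 rd.
Qed.

(** Each coordinate image of [X] contains no interval, so it is isolated around [q i]; the least of
    these radii works for all coordinates. *)
Lemma fiber_isolated n (X : pt M n -> Prop) (q : pt M n) : Def X ->
  (forall i c s, lt 0 s -> ~ forall u, near s c u -> exists p, X p /\ p i = u) ->
  exists2 r, lt 0 r & forall p, X p -> ball q r p -> p = q.
Proof.
move=> dX N.
have [i|i r r' h l|r r0 h] := @exists_min_all n (fun i r =>
    forall u, (exists p, X p /\ p i = u) -> near r (q i) u -> u = q i).
- by apply: no_interior_isolated (N i) => k t dt; dfn hG hS.
- by move=> u Xu /(near_le hG l); apply: h.
by exists r => // p Xp b; apply: funext => i; apply: h => //; exists p.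
Qed.

(* If the points [q y] are isolated in their fibers, uniformly on a ball, then they are isolated
   from all of [P] minus the section; otherwise some coordinate of the fibers covers an interval. *)
Lemma limit_section_fat_fibers n d (P : pt M n -> Prop) (s : 'I_d -> 'I_n) (q : pt M d -> pt M n) z r :
  Def P -> dmap q -> lt 0 r -> (forall y, ball z r y -> forall i, q y (s i) = y i) ->
  (forall y, ball z r y -> forall h, lt 0 h ->
     exists p, [/\ P p, ball (q y) h p & p <> q (fun i => p (s i))]) ->
  exists i z' r' c t, [/\ lt 0 r', lt 0 t & forall y u, ball z' r' y -> near t c u ->
     exists p, [/\ P p, forall j, p (s j) = y j & p i = u]].
Proof.
move=> dP dq r0 qs lim; have [U L W] := ball_properties d.
pose Py y p := P p /\ forall j, p (s j) = y j.
pose iso y t := lt 0 t /\ forall p, Py y p -> ball (q y) t p -> forall i, p i = q y i.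
have diso : drel iso.
  by move=> k t u dt du; rewrite /iso /Py /ball; dfn hG hS.
have [|z1 [r1 [r10 sub1 [hiso|hniso]]]] := U (fun y => exists t, iso y t) z r _ r0.
- by dfn hG hS.
- exfalso; have [t dt ht] := def_choice diso.
  have {}ht y : ball z1 r1 y -> iso y (t y) by move=> /hiso/ht.
  have [|z2 [r2 [r20 sub2 [e e0 he]]]] := L t z1 r1 dt r10; first by move=> y /ht[].
  have [v v0 ve] := exists_half e0.
  have [z3 [r3 [r30 sub3 hv]]] := refine_small_oscillation z2 dq r20 v0.
  (* A point [p] of [P] within [h] of [q z3] projects into the ball where [q] is almost constant. It
     is then within [v + v] of the section point of its own fiber, hence equal to it, against
     [lim]. *)
  have [h [h0 hv' hr]] := exists_min_pos hG v0 r30.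
  have z3b := ball_center z3 r30; have z3b' := sub1 _ (sub2 _ (sub3 _ z3b)).
  have [p [Pp pb]] := lim _ z3b' h h0; apply.
  set y := (fun i => p (s i)).
  have yb : ball z3 r3 y by move=> i; have := pb (s i); rewrite (qs _ z3b'); apply: near_le.
  have [_ isoy] := ht _ (sub2 _ (sub3 _ yb)).
  apply: funext; apply: isoy => // i; apply: near_le (he _ (sub3 _ yb)) _ => //.
  apply: near_le ve _ => //; apply: near_tr (hv _ _ yb z3b i) _ => //.
  exact: near_le (pb i).
pose X i y := exists c t, lt 0 t /\ forall u, near t c u -> exists p, Py y p /\ p i = u.
have dX i : Def (X i) by rewrite /X /Py; dfn hG hS.
have [|i z2 r2 z3 r3 h sub|//|z2 [r2 [r20 sub2 h2]]] := @refine_all d n (fun i z' r' =>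
    (forall y, ball z' r' y -> X i y) \/ (forall y, ball z' r' y -> ~ X i y)) z1 r1.
- by move=> i z' r' r'0; apply: U.
- by case: h => h; [left|right] => y /sub/h.
have z2b := ball_center z2 r20.
(* If no coordinate of the fiber over [z2] covered an interval, [q z2] would be isolated in that
   fiber. *)
have [i Xi] : exists i, X i z2.
  apply: contrapT => N; apply: (hniso _ (sub2 _ z2b)).
  have [||t t0 ht] := @fiber_isolated n (Py z2) (q z2); first by rewrite /Py; dfn hG hS.
    by move=> i c t t0 h; apply: N; exists i, c, t.
  by exists t; split=> // p Pp pb i; rewrite (ht p).
have {h2}hX : forall y, ball z2 r2 y -> X i y by case: (h2 i) => // h; case: (h _ z2b).
have [||z3 [r3 [r30 sub3 [c [t [t0 h]]]]]] := refine_uniform_interval L W (z := z2)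
  (R := fun y c t => forall u, near t c u -> exists p, Py y p /\ p i = u) _ _ r20 hX.
- by move=> k a b e da db de; rewrite /Py; dfn hG hS.
- by move=> y a b a' b' h _ sub u /sub/h.
exists i, z3, r3, c, t; split=> // y u yb un.
by have [p [[Pp ps] pi]] := h y yb u un; exists p.
Qed.

(** * Boxes and balls as neighborhoods *)

Lemma itv_near a b x : itv lt a b x -> exists2 e, lt 0 e & forall u, near e x u -> itv lt a b u.
Proof.
move=> [ha hb].
have [e e0 he] : exists2 e, lt 0 e & forall u, near e x u -> itv lt a None u.
  case: a ha => [a|] ha; last by exists one.
  by exists (x - a) => [|u [n1 n2]]; [lin hG ha|split=> //=; lin hG n1].
have [e' e'0 he'] : exists2 e, lt 0 e & forall u, near e x u -> itv lt None b u.
  case: b hb => [b|] hb; last by exists one.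
  by exists (b - x) => [|u [n1 n2]]; [lin hG hb|split=> //=; lin hG n2].
have [t [t0 te te']] := exists_min_pos hG e0 e'0.
by exists t => // u n; have [? _] := he u (near_le hG te n); have [_ ?] := he' u (near_le hG te' n).
Qed.

Lemma box_ball k (z : pt M k) r y :
  box lt (fun i => Some (z i - r)) (fun i => Some (z i + r)) y <-> ball z r y.
Proof.
by split=> h i; have [/= h1 h2] := h i; split=> //=; lin hG h1.
Qed.

Lemma nbhd_ball k (z : pt M k) U : nbhd lt z U <-> exists2 r, lt 0 r & forall y, ball z r y -> U y.
Proof.
split=> [[a [b [zb sub]]]|[r r0 sub]]; last first.
  exists (fun i => Some (z i - r)), (fun i => Some (z i + r)).
  by split=> [|y /box_ball/sub]; first exact/box_ball/ball_center.
have [i|i r r' h l|r r0 h] := @exists_min_all k (fun i r => forall u, near r (z i) u -> itv lt (a i) (b i) u).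
- exact: itv_near (zb i).
- by move=> u /(near_le hG l); apply: h.
by exists r => // y yb; apply: sub => i; apply: h.
Qed.


(** * Discontinuities of an equicontinuous function *)

Section Function.
Variables (m n : nat) (C : set (pt M m)) (P : set (pt M n)) (f : pt M m -> pt M n -> M).
Hypothesis dC : Def C.
Hypothesis dP : Def P.
Hypothesis df : definable_fun Def C P f.
Hypothesis ef : equicont lt C P f.

(** Definable terms are total functions, whereas [f] is controlled only on the product of [C] and
    [P]; definable choice supplies the remaining values. *)
Lemma total_extension : exists F : pt M m -> pt M n -> M,
  (forall x p, C x -> P p -> F x p = f x p) /\
  forall k (t : pt M k -> pt M m) (u : pt M k -> pt M n), dmap t -> dmap u ->
    dterm (fun x => F (t x) (u x)).
Proof.
have [|F dF hF] := @def_choice (m + n) (fun w u => CxP C P w /\ u = fj f w).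
  move=> k t u dt du.
  apply: def_ext (def_comp hS df (dmap_snoc dt du)) => x.
  by rewrite /= init_snoc snoc_max.
exists (fun x p => F (catp x p)); split=> [x p Cx Pp|k t u dt du]; last by dfn hG hS.
have CP : CxP C P (catp x p) by rewrite /CxP /= lft_catp rgt_catp.
have [|_ ->] := hF (catp x p); first by exists (fj f (catp x p)).
by rewrite /fj lft_catp rgt_catp.
Qed.

Lemma equicont_ball e x : lt 0 e -> C x -> exists2 d, lt 0 d &
  forall x' p, C x' -> P p -> ball x d x' -> near e (f x p) (f x' p).
Proof.
move=> e0 Cx; have [d [d0 h]] := ef e0 Cx; exists d => // x' p Cx' Pp b.
by apply/(nearP hG); apply: h => //; apply/(nrmP hG).
Qed.

(* Equicontinuity makes discontinuity at [(x, q)] a discontinuity of [f x] at [q]. *)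
Lemma disc_oscillation x q : C x -> P q -> ~ cont_at lt (CxP C P) (fj f) (catp x q) ->
  exists2 e, lt 0 e & forall h, lt 0 h -> exists p, [/\ P p, ball q h p & ~ near e (f x p) (f x q)].
Proof.
move=> Cx Pq; apply: contra_notP => N a b.
rewrite {1}/fj lft_catp rgt_catp => /itv_near[e e0 he].
have [v v0 ve] := exists_half e0.
have [h h0 hh] : exists2 h, lt 0 h & forall p, P p -> ball q h p -> near v (f x p) (f x q).
  apply: contrapT => N'; apply: N; exists v => // h h0; apply: contrapT => N2.
  apply: N'; exists h => // p Pp pb; apply: contrapT => N3; apply: N2; exists p; split=> //.
have [d d0 hd] := equicont_ball v0 Cx.
have [t [t0 td th]] := exists_min_pos hG d0 h0.
exists (fun i => Some (catp x q i - t)), (fun i => Some (catp x q i + t)).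
split=> [|w [Cw Pw] /box_ball wb]; first exact/box_ball/ball_center.
have bx : ball x d (lft w).
  by move=> i; have := wb (lshift n i); rewrite -{2}(lft_catp x q); apply: near_le.
have bq : ball q h (rgt w).
  by move=> i; have := wb (rshift m i); rewrite -{2}(rgt_catp x q); apply: near_le.
apply: he; apply: near_le ve _ => //.
by apply: near_tr (hd _ _ Cw Pw bx) => //; apply: near_sym; apply: hh.
Qed.

Lemma disc_fat_fibers d (s : 'I_d -> 'I_n) :
  has_interior lt (coord_proj s (proj_disc lt C P f)) ->
  exists i z' r' c t, [/\ lt 0 r', lt 0 t & forall y u, ball z' r' y -> near t c u ->
     exists p, [/\ P p, forall j, p (s j) = y j & p i = u]].
Proof.
move=> [z /nbhd_ball[r r0 hE]]; have [_ L W] := ball_properties d.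
have [F [Ff dF]] := total_extension.
(* [e] bounds from below the oscillation at [q] of the function with first argument fixed at [x]. *)
pose G x e q := C x /\ P q /\ lt 0 e /\ forall h, lt 0 h ->
  exists p, P p /\ ball q h p /\ ~ near e (F x p) (F x q).
have [|q dq hq] := @def_choicev d n (fun y q => (forall i, q (s i) = y i) /\ exists x e, G x e q).
  by move=> k t u dt du; rewrite /G /ball; dfn hG hS.
have [|x dx hx] := @def_choicev d m (fun y x => exists e, G x e (q y)).
  by move=> k t u dt du; rewrite /G /ball; dfn hG hS.
have [|e de he] := @def_choice d (fun y e => G (x y) e (q y)).
  by move=> k t u dt du; rewrite /G /ball; dfn hG hS.
have {hq}qs y : ball z r y -> (forall i, q y (s i) = y i) /\ exists x e, G x e (q y).
  move=> /hE[p [[x1 [Cx [Pp nc]] ps]]]; apply: hq; exists p; split=> // .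
  have [e1 e10 h1] := disc_oscillation Cx Pp nc; exists x1, e1; split=> //; split=> //; split=> // h h0.
  by have [p' [Pp' b n']] := h1 h h0; exists p'; rewrite !Ff.
have {hx he}hg y : ball z r y -> G (x y) (e y) (q y) by move=> /qs[_ /hx/he].
have [|z1 [r1 [r10 sub1 [e0 e00 he0]]]] := L e z r de r0; first by move=> y /hg[_ [_ []]].
have [a a0 ae] := exists_half e00; have [b b0 ba] := exists_half a0.
(* [dl y] is a modulus of equicontinuity at [x y] for the tolerance [b]. *)
have [|dl ddl hdl] := @def_choice d (fun y t => lt 0 t /\
    forall x' p, C x' -> P p -> ball (x y) t x' -> near b (F (x y) p) (F x' p)).
  by move=> k t u dt du; rewrite /ball; dfn hG hS.
have {}hdl y : ball z1 r1 y -> lt 0 (dl y) /\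
    forall x' p, C x' -> P p -> ball (x y) (dl y) x' -> near b (F (x y) p) (F x' p).
  move=> /sub1/hg[Cx _]; apply: hdl; have [t t0 ht] := equicont_ball b0 Cx.
  by exists t; split=> // x' p Cx' Pp; rewrite !Ff //; apply: ht.
have [|z2 [r2 [r20 sub2 [d0 d00 hd0]]]] := L dl z1 r1 ddl r10; first by move=> y /hdl[].
have [z3 [r3 [r30 sub3 h3]]] := refine_small_oscillation z2 dx r20 d00.
have z3b := ball_center z3 r30.
(* On this ball [x z3] lies within the modulus of every [x y], so it can replace them all; shrinking
   makes its values along the section almost constant. *)
have [|z4 [r4 [r40 sub4 h4]]] := W (fun y => F (x z3) (q y)) z3 r3 b _ r30 b0.
  by dfn hG hS.
have [Cx3 _] := hg _ (sub1 _ (sub2 _ (sub3 _ z3b))).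
apply: (limit_section_fat_fibers (z := z4) (r := r4) dP dq r40) => [y /sub4/sub3/sub2/sub1/qs[]//|].
move=> y yb h h0.
(* Below [w], the projection of [p] stays in the ball about [z4]. *)
have [t t0 ht] := ball_open yb; have [w [w0 wh wt]] := exists_min_pos hG h0 t0.
have yb3 := sub4 _ yb; have yb2 := sub3 _ yb3; have yb1 := sub2 _ yb2; have ybz := sub1 _ yb1.
have [_ [Pq [_ /(_ w w0)[p [Pp [pb pfar]]]]]] := hg _ ybz.
exists p; split=> // [i|E]; first exact: near_le wh (pb i).
(* Were [p] on the section, the values at [p] and [q y] would be linked by three moves of size [b]:
   from [x y] to [x z3], along the section, and back. Their sum is at most [e y]. *)
apply: pfar.
have yb' : ball z4 r4 (fun i => p (s i)).
  by apply: ht => i; have := pb (s i); rewrite (proj1 (qs _ ybz)); apply: near_le.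
have xb : ball (x y) (dl y) (x z3).
  by move=> i; apply: near_le (hd0 _ yb2) _ => //; apply: h3.
have [_ hdy] := hdl _ yb1.
have n1 := hdy _ _ Cx3 Pp xb; have n3 := near_sym (hdy _ _ Cx3 Pq xb).
have n2 := h4 _ _ yb' yb; rewrite -E in n2.
have l : le (b + b + b) (e y).
  by have l0 := he0 _ yb1; apply: (le_tr hG) l0; lin hG ba ba b0 ae.
by apply: near_le l _ => //; apply: near_tr n3 => //; apply: near_tr n2.
Qed.

End Function.

(** * Fat fibers raise the dimension *)

(** Coordinate projections in [proj_int] list their coordinates in increasing order, so an appended
    coordinate must be sorted into place. *)
Lemma increasing_reordering d n (t : 'I_d -> 'I_n) : injective t ->
  exists2 o : 'I_d -> 'I_d, injective o & forall i j : 'I_d, (i < j)%N -> (t (o i) < t (o j))%N.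
Proof.
move=> tinj; pose l := sort (relpre t leq) (enum 'I_d).
have sz : size l = d by rewrite size_sort size_enum_ord.
have ul : uniq l by rewrite sort_uniq enum_uniq.
have sl : sorted (relpre t leq) l by apply: sort_sorted => i j; apply: leq_total.
pose o (i : 'I_d) := nth i l i.
have onth (i j : 'I_d) : o i = nth j l i by apply: set_nth_default; rewrite sz.
have oinj : injective o.
  move=> i j; rewrite (onth i j) /o => /eqP.
  by rewrite nth_uniq ?sz // => /eqP/val_inj.
exists o => // i j ij; rewrite ltn_neqAle; apply/andP; split.
  by apply/eqP => /val_inj/tinj/oinj E; rewrite E ltnn in ij.
rewrite (onth i j).
have tr : transitive (relpre t leq) by move=> a b c; apply: leq_trans.
have rf : reflexive (relpre t leq) by move=> a; apply: leqnn.
by apply: (sorted_leq_nth tr rf j sl) => //; rewrite ?inE ?sz //; apply: ltnW.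
Qed.

Lemma fat_fibers_proj_int n d (P : set (pt M n)) (s : 'I_d -> 'I_n) i z r c e :
  (forall i j : 'I_d, (i < j)%N -> (s i < s j)%N) -> lt 0 r -> lt 0 e ->
  (forall y u, ball z r y -> near e c u ->
     exists p, [/\ P p, forall j, p (s j) = y j & p i = u]) ->
  (d.+1 <= n)%N /\ proj_int lt P d.+1.
Proof.
move=> sinc r0 e0 h; have zb := ball_center z r0.
have sinj : injective s.
  move=> a b E; apply: val_inj; case: (ltngtP a b) => // /sinc; rewrite E ltnn //.
(* Over the single base point [z], coordinate [i] takes both values [c] and [c + v], while the
   coordinates in [s] are fixed. *)
have iNs j : s j <> i.
  move=> E; have [v v0 ve] := dense0 e0.
  have [p [_ ps pi]] := h z c zb (near_refl hG c e0).
  have [|p' [_ ps' pi']] := h z (c + v) zb; first by apply: near_right => //; [lin hG v0|lin hG ve].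
  have : lt c (c + v) by lin hG v0.
  by rewrite -pi' -pi -E ps ps' ltxx.
pose t (j : 'I_d.+1) := if unlift ord_max j is Some j' then s j' else i.
have tmax : t ord_max = i by rewrite /t unlift_none.
have twid j : t (widen_ord (leqnSn d) j) = s j.
  rewrite /t; case: unliftP => [j'|] /(congr1 val) /=.
    by rewrite /bump leqNgt ltn_ord /= => /val_inj ->.
  by move=> E; have := ltn_ord j; rewrite E ltnn.
have tinj : injective t.
  move=> a b; case: (ord_maxVwiden a) => [->|[a' ->]]; case: (ord_maxVwiden b) => [->|[b' ->]] //;
    rewrite ?tmax ?twid //.
  - by move=> E; case: (iNs b').
  - by move/iNs.
  - by move/sinj ->.
split; first by have := leq_card t tinj; rewrite !card_ord.
have [o oinj oinc] := increasing_reordering tinj.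
exists (t \o o); split=> //.
have [o' oK o'K] := injF_bij oinj.
have [w [w0 wr we]] := exists_min_pos hG r0 e0.
(* The center is permuted by [o]; the inverse [o'] brings a point of the ball back to the order base
   first, [i] last. *)
exists (fun k => snoc z c (o k)); apply/nbhd_ball; exists w => // y yb.
have yb' : ball (snoc z c) w (fun j => y (o' j)) by move=> j; have := yb (o' j); rewrite o'K.
have [b nr] := ball_snoc wr we yb'.
have [p [Pp ps pi]] := h _ _ b nr; exists p; split=> // k /=.
rewrite -[in LHS](oK k); case: (ord_maxVwiden (o k)) => [->|[j ->]]; rewrite ?tmax ?twid //.
Qed.
End Structure.

(** * The discrete case and the conclusion *)

Lemma proj_int0 (M : zmodType) (lt : rel M) n (X : set (pt M n)) x : X x -> proj_int lt X 0.
Proof.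
move=> Xx; exists (fun i : 'I_0 => match i with Ordinal _ h => match notF h with end end).
split=> [[]//|]; exists (fun _ => 0), (fun _ => None), (fun _ => None).
by split=> [[]//|y _]; exists x; split=> // -[].
Qed.

(** Without density the group is either trivial or has a least positive element [e], and then the
    ball of radius [e] about [z] is a single point. *)
Lemma cont_at_isolated (M : zmodType) (lt : rel M) k (S : set (pt M k)) g z :
  ordered_abelian_group lt ->
  ~ (exists2 one, lt 0 one & forall e, lt 0 e -> exists2 v, lt 0 v & lt v e) ->
  cont_at lt S g z.
Proof.
move=> hG N a b gz.
have [[one one0]|N0] := pselect (exists one, lt 0 one); last first.
  have M0 (x y : M) : x = y.
    by case: (ltP hG x y) => // l; case: N0; [exists (y - x)|exists (x - y)]; lin hG l.
  exists (fun _ => None), (fun _ => None); split=> // w _ _.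
  by rewrite (_ : w = z) //; apply: funext.
have [e [e0 he]] : exists e, lt 0 e /\ forall v, lt 0 v -> ~ lt v e.
  apply: contrapT => Ne; apply: N; exists one => // e e0.
  by apply: contrapT => Nv; apply: Ne; exists e; split=> // v v0 ve; apply: Nv; exists v.
exists (fun i => Some (z i - e)), (fun i => Some (z i + e)).
split=> [|w _ /(box_ball hG) wb]; first exact/(box_ball hG)/ball_center.
rewrite (_ : w = z) //; apply: funext => i; have [n1 n2] := wb i.
case: (ltP hG (w i) (z i)) => // l; exfalso.
  by apply: (he (z i - w i)); [lin hG l|lin hG n1].
by apply: (he (w i - z i)); [lin hG l|lin hG n2].
Qed.

Theorem mainTheorem2 (M : zmodType) (lt : rel M)
  (Def : forall k, set (pt M k) -> Prop)
  (m n : nat) (C : set (pt M m)) (P : set (pt M n)) (f : pt M m -> pt M n -> M) :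
  ordered_abelian_group lt -> structure_on lt Def ->
  def_complete lt Def -> loc_omin lt Def ->
  Def m C -> closed_set lt C ->
  Def n P -> (exists p, P p) ->
  definable_fun Def C P f -> equicont lt C P f ->
  dim_lt (dimension lt (proj_disc lt C P f)) (dimension lt P).
Proof.
move=> hG hS hC hL dC _ dP neP df ef.
rewrite /dimension (asboolT neP); case: asboolP => //= -[q0 Eq0].
have [[one one0 dense0]|N] := pselect
  (exists2 one, lt 0 one & forall e, lt 0 e -> exists2 v, lt 0 v & lt v e); last first.
  by have [x [_ [_ []]]] := Eq0; apply: cont_at_isolated.
set E := proj_disc lt C P f in Eq0 *.
(* Index 0 always qualifies, so the maximum defining the dimension is attained at some [d]; it
   remains to see that [d.+1] qualifies for [P]. *)
have E0 : `[< proj_int lt E (@ord0 n) >] by apply/asboolP/(proj_int0 lt Eq0).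
rewrite (bigmax_eq_arg _ E0); case: arg_maxnP => // d /asboolP[s [sinc hint]] _.
have [i [z [r [c [e [r0 e0 h]]]]]] :=
  disc_fat_fibers hG hS hC hL one0 dense0 dC dP df ef hint.
have [dn dP1] := fat_fibers_proj_int hG one0 dense0 sinc r0 e0 h.
by apply: (leq_bigmax_cond (Ordinal (dn : (d.+1 < n.+1)%N))); apply/asboolP.
Qed.
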